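(* Let $\sigma=\{\sigma_i \mid i\in I\}$ be a partition of the set $\mathbb{P}$ of all primes and let $G$ be a finite group. Suppose that $G$ possesses a complete Hall $\sigma$-set $\mathcal{H}$ all of whose members are supersoluble. If, for every non-cyclic member $H$ of $\mathcal{H}$, every maximal subgroup of $H$ permutes with all other members of $\mathcal{H}$ (that is, with every member of $\mathcal{H}$ different from $H$), then $G$ is supersoluble.
   Context: All groups are finite. $\pi(G)$ denotes the set of all primes dividing $|G|$. $\sigma=\{\sigma_i\mid i\in I\}$ is a partition of the set $\mathbb{P}$ of all primes, i.e. $\mathbb{P}=\bigcup_{i\in I}\sigma_i$ and $\sigma_i\cap\sigma_j=\emptyset$ for all $i\neq j$. For a set $\pi$ of primes, a Hall $\pi$-subgroup of $G$ is a subgroup whose order is divisible only by primes in $\pi$ and whose index in $G$ is divisible by no prime in $\pi$. Two subgroups $A$, $B$ of $G$ permute if $AB=BA$. A set $\mathcal{H}$ of subgroups of $G$ is a complete Hall $\sigma$-set of $G$ if every member $\neq 1$ of $\mathcal{H}$ is a Hall $\sigma_i$-subgroup of $G$ for some $i\in I$, and $\mathcal{H}$ contains exactly one Hall $\sigma_i$-subgroup of $G$ for every $i$ such that $\sigma_i\cap\pi(G)\neq\emptyset$. *)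

(* Defs.v *)
From mathcomp Require Import all_boot all_fingroup all_solvable.

Set Implicit Arguments.
Unset Strict Implicit.
Unset Printing Implicit Defensive.

Local Open Scope group_scope.

(* Existence of a series 1 = G_0 <= G_1 <= ... <= G_n = G whose terms are all *)
(* normal in G and whose factors G_(k+1) / G_k are cyclic. [invariant_factor  *)
(* G H K] says that G normalises H and K and that H <| K; as the series is    *)
(* increasing and ends at G, its terms are then normal subgroups of G.        *)
Definition supersoluble (gT : finGroupType) (G : {group gT}) : Prop :=
  exists s : seq {group gT},
    path [rel H K : {group gT} | invariant_factor G H K && cyclic (K / H)]
         1%G s
    /\ last 1%G s = G.

(* Empty blocks are allowed, so distinct indices may share the empty block.   *)
Definition prime_partition (I : Type) (sigma : I -> nat_pred) : Prop :=
  [/\ forall i p, p \in sigma i -> prime p,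
      forall p, prime p -> exists i, p \in sigma i
    & forall i j, i <> j -> forall p, ~ (p \in sigma i /\ p \in sigma j)].

Definition complete_Hall_set (I : Type) (sigma : I -> nat_pred)
    (gT : finGroupType) (G : {group gT}) (HH : {set {group gT}}) : Prop :=
  [/\ forall H : {group gT}, H \in HH -> H \subset G,
      forall H : {group gT}, H \in HH -> H :!=: 1 ->
        exists i, (sigma i).-Hall(G) H
    & forall i, (exists p, p \in sigma i /\ p \in \pi(G)) ->
        exists! H : {group gT}, H \in HH /\ (sigma i).-Hall(G) H].

Definition permutes (gT : finGroupType) (A B : {group gT}) : Prop :=
  A * B = B * A.

(* Main.v *)
(** Let G be a minimal counterexample.  Quotients inherit the hypothesis, so
    every proper quotient of G is supersoluble.

    If G has a nontrivial soluble normal subgroup, then G is soluble.  Let N be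
    minimal normal in G, inside the member H.  If N is not in Phi(H), let M be a
    maximal subgroup of H not containing N.  If H is not cyclic, M permutes with
    the other members and the intersection of M and N is normal in G, hence
    trivial, so N has prime order.  If N <= Phi(H), the Sylow subgroup P of G
    for the largest prime p is normal; for N <= P, supersolubility of G / Phi(P)
    shows that commutators and (p - 1)-th powers of G centralise N, so that N
    is again cyclic.

    Otherwise a minimal normal subgroup N is perfect, and its Sylow p-subgroups
    for p minimal in pi(N) are not cyclic.  Let H be the member for p.

    - If all members permute: the intersection of H and N is not in Phi(H) (a
      relative of Tate's theorem), so for a maximal subgroup M of H missing it
      the product of M with the other members has prime index l and trivial
      core.  Acting on its cosets, H has a normal subgroup of order l on which
      M acts faithfully, so that M is cyclic and H has cyclic Sylow subgroups.

    - Otherwise two cyclic members do not permute.  The product X of the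
      noncyclic members generates with each cyclic member a proper, hence
      supersoluble, subgroup.  If X is not abelian, a nontrivial subgroup of a
      Sylow subgroup of X is normalised by all of these, hence by G.  If X is
      abelian, then N has a normal p-complement by a fusion argument. *)

Require Import Defs.
From mathcomp Require Import all_boot all_fingroup all_algebra all_solvable.
From mathcomp Require Import finfield mxrepresentation mxabelem.

Set Implicit Arguments.
Unset Strict Implicit.
Unset Printing Implicit Defensive.
Import GRing.Theory FiniteModule.
Local Open Scope group_scope.

(** * Supersoluble groups *)

Section Supersoluble.

Implicit Types gT rT : finGroupType.

Definition cyclic_factor gT (G K L : {group gT}) : bool :=
  invariant_factor G K L && cyclic (L / K).

(** A generator lifted to L survives a further quotient; this is how cyclicity of a factor is
    carried over to G / C below. *)
Lemma cyclic_quotientP gT (K L : {group gT}) : K <| L ->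
  reflect (exists2 x, x \in L & L \subset K <*> <[x]>) (cyclic (L / K)).
Proof.
move=> nsKL; have [sKL nKL] := andP nsKL.
apply: (iffP idP) => [/cyclicP[y Ly] | [x Lx sLKx]].
  have: y \in L / K by rewrite Ly cycle_id.
  case/morphimP=> x nKx Lx def_y; exists x => //.
  have nKcx : <[x]> \subset 'N(K) by rewrite cycle_subG.
  rewrite -(quotientSGK nKL) ?joing_subl //= quotientYidl //.
  by rewrite quotient_cycle // -def_y -Ly.
have nKx := subsetP nKL _ Lx.
rewrite (cyclicS (quotientS K sLKx)) //= quotientYidl ?cycle_subG //.
by rewrite quotient_cycle ?cycle_cyclic.
Qed.

(** Subgroups and quotients are both handled by applying one operation to all terms of a series. *)
Lemma supersoluble_map gT rT (G : {group gT}) (H : {group rT})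
    (f : {group gT} -> {group rT}) :
    f 1%G = 1%G -> f G = H ->
    (forall K L, cyclic_factor G K L -> cyclic_factor H (f K) (f L)) ->
  supersoluble G -> supersoluble H.
Proof.
move=> f1 fG fP [s [ps ls]]; exists (map f s); split; last first.
  by rewrite -f1 last_map ls.
by rewrite -f1; apply: homo_path ps => K L /= /fP.
Qed.

Lemma cyclic_factorI gT (G H K L : {group gT}) :
  H \subset G -> cyclic_factor G K L -> cyclic_factor H (K :&: H) (L :&: H).
Proof.
move=> sHG /andP[/and3P[nKG nLG nsKL] cKL].
have [sKL nKL] := andP nsKL.
apply/andP; split.
  apply/and3P; split; first by rewrite normsI ?normG ?(subset_trans sHG).
    by rewrite normsI ?normG ?(subset_trans sHG).
  by rewrite /normal setSI //= normsI ?subsetIr ?subIset ?nKL ?normG ?orbT.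
have nKLH : L :&: H \subset 'N(K) by rewrite subIset ?nKL.
have eqK : K :&: (L :&: H) = K :&: H by rewrite setIA (setIidPl sKL).
rewrite /= -eqK (isog_cyclic (second_isog nKLH)).
by rewrite (cyclicS _ cKL) ?quotientS ?subsetIl.
Qed.

Lemma supersolubleS gT (G H : {group gT}) :
  H \subset G -> supersoluble G -> supersoluble H.
Proof.
move=> sHG; apply: (@supersoluble_map _ _ _ _ (fun K => (K :&: H)%G)).
- by apply/val_inj; rewrite /= setI1g.
- by apply/val_inj; rewrite /= (setIidPr sHG).
by move=> K L; apply: cyclic_factorI.
Qed.

Lemma supersoluble_quotient gT (G C : {group gT}) :
  G \subset 'N(C) -> supersoluble G -> supersoluble (G / C)%G.
Proof.
(* [supersoluble_map] quantifies over all cyclic factors, not only those of a given series, so K is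
   cut down to G to make it normalise C. *)
move=> nCG; apply: (@supersoluble_map _ _ _ _ (fun K => ((K :&: G) / C)%G)).
- by apply/val_inj; rewrite /= setI1g quotient1.
- by apply/val_inj; rewrite /= setIid.
move=> K L /(cyclic_factorI (subxx G)) /andP[/and3P[nKG nLG nsKLG] cKLG].
apply/andP; split.
  rewrite /invariant_factor /= !quotient_norms //=.
  exact: quotient_normal.
have sLN : L :&: G \subset 'N(C) by rewrite subIset ?nCG ?orbT.
have nsq := quotient_normal C nsKLG.
have [x LGx sLx] := cyclic_quotientP nsKLG cKLG.
apply/(cyclic_quotientP nsq); exists (coset C x); first exact: mem_quotient.
have nCx : x \in 'N(C) := subsetP sLN x LGx.
rewrite -quotient_cycle // -quotientY ?cycle_subG ?quotientS //.
exact: subset_trans (normal_sub nsKLG) sLN.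
Qed.

Lemma supersoluble1 gT (G : {group gT}) : G :=: 1 -> supersoluble G.
Proof. by move=> G1; exists [::]; split=> //; apply/val_inj. Qed.

Lemma supersoluble_ext gT (G N : {group gT}) :
  N <| G -> cyclic N -> supersoluble (G / N)%G -> supersoluble G.
Proof.
move=> nsNG cycN [s [ps ls]].
have [sNG nNG] := andP nsNG.
(* As f sends 1 to N, the pulled-back series starts at N, and N itself is put in front as the first
   step above 1. *)
pose f (K : {group coset_of N}) := (coset N @*^-1 (K :&: (G / N)))%G.
have f1 : f 1%G = N.
  by apply/val_inj; rewrite /= setIC (setIidPr (sub1G _)) -kerE ker_coset.
exists (N :: map f s); split; last first.
  have -> : last 1%G (N :: map f s) = last (f 1%G) (map f s) by rewrite f1.
  rewrite last_map ls; apply/val_inj; rewrite /= setIid.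
  by rewrite quotientGK.
rewrite [path _ _ _]/= /invariant_factor norms1 nNG normal1 /=.
rewrite -(isog_cyclic (quotient1_isog _)) cycN /=.
suff: path (@cyclic_factor gT G) (f 1%G) (map f s) by rewrite f1.
apply: homo_path ps => K L.
case/(cyclic_factorI (subxx _))/andP=> /and3P[nKG nLG nsKL] cKL.
have nfG (M : {group coset_of N}) : G / N \subset 'N(M) ->
   G \subset 'N(coset N @*^-1 M).
  move=> nMG; rewrite -(quotientGK nsNG).
  rewrite (subset_trans _ (morphpre_norm _ _)) //.
  exact: morphpreS.
rewrite /cyclic_factor /invariant_factor /= nfG // nfG // morphpre_normal
  ?subIset ?sub_im_coset //= ?orbT //.
rewrite nsKL /=.
have nsp : coset N @*^-1 (K :&: (G / N)) <| coset N @*^-1 (L :&: (G / N)).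
  by rewrite cosetpre_normal.
have nsNp (M : {group coset_of N}) : N <| coset N @*^-1 M.
  rewrite /normal -{1}[N : {set gT}]ker_coset kerE morphpreS ?sub1G //=.
  exact: subsetIl.
have sNp : N \subset coset N @*^-1 (K :&: (G / N)) := normal_sub (nsNp _).
have := third_isog sNp (nsNp _) nsp.
by rewrite !cosetpreK => /isog_cyclic <-.
Qed.

(** The first nontrivial term of a series is a cyclic normal subgroup, all of whose subgroups are
    characteristic. This is the basis of the inductions on |G| below. *)
Lemma supersoluble_prime_normal gT (G : {group gT}) :
  supersoluble G -> G :!=: 1 ->
  exists N : {group gT}, [/\ N <| G, prime #|N| & supersoluble (G / N)%G].
Proof.
move=> ssG ntG.
suff [N nsNG pN]: exists2 N : {group gT}, N <| G & prime #|N|.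
  by exists N; split=> //; apply: supersoluble_quotient ssG; case/andP: nsNG.
case: ssG => s [].
elim: s => [|K s IHs] /= => [_ G1|]; first by rewrite -G1 eqxx in ntG.
case: (eqsVneq K 1) => [/val_inj-> /andP[_]|ntK]; first exact: IHs.
case/andP=> /andP[/and3P[_ nKG _] cK] ps lastG.
rewrite -(isog_cyclic (quotient1_isog _)) in cK.
have sKG: K \subset G.
  rewrite -lastG; elim: s K {IHs nKG cK ntK lastG} ps => //= L s IHs K.
  by case/andP=> /andP[/and3P[_ _ /andP[sKL _]] _] /IHs; apply: subset_trans.
have [p p_pr] : exists2 p, prime p & p %| #|K|.
  by exists (pdiv #|K|); rewrite ?pdiv_dvd ?pdiv_prime ?cardG_gt1.
case/(Cauchy p_pr) => x Kx ox; exists <[x]>%G; last by rewrite -orderE ox.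
have sxK: <[x]> \subset K by rewrite cycle_subG.
have chx : <[x]> \char K.
  by have [a Ka] := cyclicP cK; rewrite Ka cycle_subgroup_char -?Ka.
by rewrite /normal (subset_trans sxK sKG) (char_norm_trans chx).
Qed.

Lemma supersoluble_sol gT (G : {group gT}) : supersoluble G -> solvable G.
Proof.
have [n] := ubnP #|G|; elim: n gT G => // n IHn gT G ltGn ssG.
case: (eqsVneq G 1) => [->|ntG]; first exact: solvable1.
have [N [nsNG pN ssGN]] := supersoluble_prime_normal ssG ntG.
rewrite (series_sol nsNG) abelian_sol ?cyclic_abelian ?prime_cyclic //=.
apply: IHn ssGN; apply: leq_trans (ltn_quotient _ _) _ => //.
  by rewrite -cardG_gt1 prime_gt1.
exact: normal_sub.
Qed.

(** A acts on C through the automorphism group of C, which is abelian. *)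
Lemma cyclic_der1_cent gT (C A : {group gT}) :
  cyclic C -> A \subset 'N(C) -> A^`(1) \subset 'C(C).
Proof.
move=> cC nCA.
have sA'N: A^`(1) \subset 'N(C) by apply: subset_trans (der_sub 1 A) nCA.
rewrite -ker_conj_aut kerE -sub_morphim_pre // subG1.
rewrite /= morphim_der //; apply/eqP/derG1P.
exact: abelianS (Aut_conj_aut _ _) (Aut_cyclic_abelian cC).
Qed.

Lemma cyclic_coprime_cent gT (C A : {group gT}) :
  cyclic C -> A \subset 'N(C) -> coprime #|A| (totient #|C|) ->
  A \subset 'C(C).
Proof.
move=> cC nCA coAC; rewrite -ker_conj_aut kerE -sub_morphim_pre // subG1.
rewrite trivg_card1 -dvdn1 -(eqP coAC) dvdn_gcd.
by rewrite dvdn_morphim -card_Aut_cyclic // cardSg ?Aut_conj_aut.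
Qed.

(* The lower central series of G' descends at least as fast as the series of
   G. *)
Lemma supersoluble_der1_nil gT (G : {group gT}) :
  supersoluble G -> nilpotent G^`(1).
Proof.
(* [nilpotent] asks that every H contained in [H, G'] be trivial; such an H is pushed down the
   series, since G' centralises each factor. *)
case=> s [ps ls]; apply/forall_inP=> H /subsetIP[sHG' sHH].
suff: H \subset last 1%G s -> H :==: 1.
  by rewrite ls; apply; apply: subset_trans sHG' (der_sub 1 G).
elim/last_ind: s ps {ls} => [|s L IHs]; first by rewrite subG1.
rewrite rcons_path last_rcons => /andP[ps].
set K := last _ _ in IHs * => /andP[/and3P[nKG nLG nsKL] cKL] sHL.
apply: IHs => //; apply: subset_trans sHH _.
have sHG := subset_trans sHG' (der_sub 1 G).
have sG'G := der_sub 1 G.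
rewrite -quotient_cents2 ?(subset_trans _ nKG) //.
rewrite quotient_der // centsC.
apply: subset_trans (cyclic_der1_cent cKL (quotient_norms _ nLG)) _.
by rewrite centS ?quotientS.
Qed.

Definition gt_pred (w : nat) : nat_pred := [pred q | w < q].

(** Induction through a normal N of prime order. The Hall subgroup of G / N pulls back to T, which
    is the one sought if |N| > w. Otherwise T = NK by Schur-Zassenhaus, and K centralises N because
    |Aut N| = |N| - 1 has only prime divisors below w; so K is normal in T and characteristic
    there. *)
Lemma supersoluble_Hall_gt gT (G : {group gT}) w :
  supersoluble G -> (gt_pred w).-Hall(G) 'O_(gt_pred w)(G).
Proof.
have [n] := ubnP #|G|; elim: n gT G => // n IHn gT G ltGn ssG.
case: (eqsVneq G 1) => [->|ntG].
  have -> : 'O_(gt_pred w)(1 : {set gT}) = 1 by apply/trivgP; rewrite pcore_sub.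
  by rewrite pHallE subxx cards1 part_p'nat.
have [N [nsNG pN ssGN]] := supersoluble_prime_normal ssG ntG.
have [sNG nNG] := andP nsNG.
have ntN : N :!=: 1 by rewrite -cardG_gt1 prime_gt1.
have := IHn _ _ (leq_trans (ltn_quotient ntN sNG) ltGn) ssGN.
set pi := gt_pred w => hallq.
have [T defT sNT nsTG] := inv_quotientN nsNG (pcore_normal pi (G / N)).
rewrite /= defT in hallq.
have [sTG nTG] := andP nsTG; have nsNT := normalS sNT sTG nsNG.
have [_ piTN pi'GT] := and3P hallq.
have {}pi'GT : pi^'.-nat #|G : T|.
  by move: pi'GT; rewrite /= index_quotient_eq // subIset ?sNT ?orbT.
have [piN|pi'N] := boolP (#|N| \in pi).
  have piT : pi.-group T.
    by rewrite -(pquotient_pgroup _ (normal_norm nsNT)) // /pgroup pnatE.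
  have hallT: pi.-Hall(G) T by rewrite /pHall sTG piT.
  by rewrite (normal_Hall_pcore hallT).
have pi'gN: pi^'.-group N by rewrite /pgroup pnatE // inE.
have hallN: Hall T N.
  rewrite /Hall sNT -card_quotient ?normal_norm //.
  by rewrite coprime_sym (pnat_coprime piTN).
have /splitsP[K /complP[tiNK defNK]] := SchurZassenhaus_split hallN nsNT.
have sKT: K \subset T by rewrite -defNK mulG_subr.
have oK: #|K| = #|T / N|.
  rewrite card_quotient ?normal_norm // -divgS // -defNK TI_cardMg //.
  by rewrite mulKn.
have piK: pi.-group K by rewrite /pgroup oK.
have cNK: K \subset 'C(N).
  apply: cyclic_coprime_cent; rewrite ?prime_cyclic //.
    exact: subset_trans sKT (normal_norm nsNT).
  rewrite totient_prime //.
  apply: (pnat_coprime piK); apply/pnatP => [|q q_pr].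
    by rewrite -subn1 subn_gt0 prime_gt1.
  move/dvdn_leq; rewrite -subn1 subn_gt0 prime_gt1 // => /(_ isT) leq1.
  move: pi'N; rewrite !inE -!leqNgt; apply: leq_trans.
  by apply: leq_trans leq1 _; rewrite leq_subr.
have nsKT: K <| T.
  rewrite /normal sKT -{1}defNK mul_subG ?normG //.
  by rewrite cents_norm // centsC.
have hallKT: pi.-Hall(T) K.
  rewrite /pHall sKT piK -divgS // -defNK TI_cardMg // mulnK //.
have nsKG: K <| G.
  rewrite -(normal_Hall_pcore hallKT nsKT).
  exact: char_normal_trans (pcore_char _ _) nsTG.
have hallK: pi.-Hall(G) K.
  apply/and3P; split=> //; first exact: normal_sub.
  rewrite -(Lagrange_index sTG sKT) pnatM pi'GT.
  by case/and3P: hallKT.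
by rewrite (normal_Hall_pcore hallK).
Qed.

Lemma maximal_mulg gT (G M N : {group gT}) :
  maximal M G -> N \subset G -> M \subset 'N(N) -> ~~ (N \subset M) ->
  M * N = G.
Proof.
move=> maxM sNG nNM not_sNM; have [pMG maxM2] := maxgroupP maxM.
rewrite -norm_joinEl //.
have /eqVproper[//|pMNG] : M <*> N \subset G.
  by rewrite join_subG sNG proper_sub.
case/negP: not_sNM; rewrite -(maxM2 (M <*> N)%G) ?joing_subl ?joing_subr //.
Qed.

(** A normal subgroup N of prime order either lies in M and is factored out, or is complemented by
    M, whose index is then |N|. *)
Lemma supersoluble_maximal_index gT (G M : {group gT}) :
  supersoluble G -> maximal M G -> prime #|G : M|.
Proof.
have [n] := ubnP #|G|; elim: n gT G M => // n IHn gT G M ltGn ssG maxM.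
have sMG := proper_sub (maxgroupp maxM).
have ntG: G :!=: 1.
  by apply: contraTneq (maxgroupp maxM) => ->; rewrite properE sub1G andbF.
have [N [nsNG pN ssGN]] := supersoluble_prime_normal ssG ntG.
have [sNG nNG] := andP nsNG.
have ntN : N :!=: 1 by rewrite -cardG_gt1 prime_gt1.
have nNM := subset_trans sMG nNG.
have [sNM|not_sNM] := boolP (N \subset M).
  have nsNM := normalS sNM sMG nsNG.
  have sGNM : G :&: N \subset M by rewrite subIset ?sNM ?orbT.
  rewrite -(index_quotient_eq sGNM sMG nNG).
  rewrite (IHn _ _ _ (leq_trans (ltn_quotient ntN sNG) ltGn) ssGN) //.
  by rewrite quotient_maximal.
have defG := maximal_mulg maxM sNG nNM not_sNM.
have tiMN : M :&: N = 1 by rewrite setIC prime_TIg.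
by rewrite -divgS // -defG TI_cardMg // mulKn.
Qed.
Lemma supersoluble_max_Sylow_normal gT p (G P : {group gT}) : prime p ->
    (forall q, q \in \pi(G) -> q <= p) -> supersoluble G -> p.-Sylow(G) P ->
  P <| G.
Proof.
move=> p_pr max_p ssG sylP.
(* Since p is the largest prime divisor of |G|, a prime divisor exceeds p - 1 only if it equals
   p. *)
have sylgt : p.-Sylow(G) 'O_(gt_pred p.-1)(G).
  rewrite -(eq_in_pHall _ _ (pi := gt_pred p.-1)) => [|q /max_p leqp].
    exact: supersoluble_Hall_gt.
  by rewrite !inE prednK ?prime_gt0 // eqn_leq leqp.
have def_p := normal_Hall_pcore sylgt (pcore_normal _ _).
rewrite -def_p in sylgt.
by rewrite (eq_Hall_pcore sylgt sylP) pcore_normal.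
Qed.

End Supersoluble.

(** * Normal p-complements *)

Section Burnside.

Variables (gT : finGroupType) (p : nat) (G P : {group gT}).
Hypothesis sylP : p.-Sylow(G) P.

(* Sylow's theorem in the centraliser of the common element. *)
Lemma abelian_Sylow_fusion (a g : gT) :
    abelian P -> a \in P -> a ^ g \in P -> g \in G ->
  exists2 w, w \in 'N_G(P) & a ^ w = a ^ g.
Proof.
move=> abP Pa Pag Gg; have [sPG pP _] := and3P sylP.
have sylC (Q : {group gT}) : p.-Sylow(G) Q -> Q \subset 'C[a ^ g] ->
    p.-Sylow('C_G[a ^ g]) Q.
  move=> sylQ cQ; apply: (pHall_subl _ (subsetIl _ _) (sylQ)).
  by rewrite subsetI (pHall_sub sylQ).
have sylP1 : p.-Sylow('C_G[a ^ g]) P.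
  by apply: sylC; rewrite ?sub_cent1 ?(subsetP abP).
have sylP2 : p.-Sylow('C_G[a ^ g]) (P :^ g).
  apply: (sylC (P :^ g)%G); first by rewrite pHallJ.
  by rewrite /= cent1J conjSg sub_cent1 (subsetP abP).
have [c /setIP[Gc cc] defP] := Sylow_trans sylP2 sylP1.
exists (g * c); last by rewrite conjgM [LHS]conjgE -(cent1P cc) mulKg.
by rewrite inE groupM //=; apply/normP; rewrite conjsgM -defP.
Qed.

(** Elements of P conjugate in G are conjugate in N_G(P), hence equal. The transfer of G into P
    therefore sends g in P to its power with exponent |G : P|, which is prime to p; it is injective
    on P and its kernel is the complement. *)
Lemma Burnside_normal_complement :
  'N_G(P) \subset 'C(P) -> p^'.-Hall(G) 'O_p^'(G).
Proof.
move=> cPN; have [sPG pP p'GP] := and3P sylP.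
have abP : abelian P.
  by apply: subset_trans cPN; rewrite subsetI sPG normG.
have abA : abelian (idm_morphism P @* P) by rewrite morphim_idm.
have PA : (idm_morphism P @* P)%G = P by apply/val_inj; rewrite /= morphim_idm.
pose V := transfer_morphism G abA.
have injV : 'ker_P V = 1.
  apply/trivgP/subsetP=> g /setIP[Pg /kerP Vg1].
  have Gg := subsetP sPG g Pg.
  have {Vg1} := Vg1 Gg.
  (* Each cycle of g on the right cosets of P contributes a conjugate of a power of g, the exponent
     being the cycle length; these lengths add up to |G : P|. *)
  have trX := transversalP (rcosets_cycle_partition sPG Gg).
  rewrite /= (transfer_cycle_expansion sPG abA Gg trX).
  rewrite (eq_bigr (fun x => fmod abA g *+ #|<[g]> : P :* x|)%R); last first.
    move=> x Xx; set n := #|_ : _|.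
    have Gx : x \in G by apply: (subsetP (transversal_sub trX)).
    have Pgx : (g ^+ n) ^ x^-1 \in P.
      have := mulg_exp_card_rcosets P g x.
      by rewrite mem_rcoset conjgE invgK mulgA.
    rewrite /restrm /= /idm /=.
    have [w NPw <-] := abelian_Sylow_fusion abP (groupX n Pg) Pgx (groupVr Gx).
    rewrite conjgE -(centP (subsetP cPN w NPw) _ (groupX n Pg)) mulKg.
    by rewrite fmodX ?PA.
  rewrite sumrMnr (sum_index_rcosets_cycle sPG Gg trX) -fmodX ?PA //.
  move/(congr1 val); rewrite /= fmodK ?groupX ?PA // => gm1.
  rewrite inE -order_eq1; apply/eqP.
  apply: (pnat_1 (mem_p_elt pP Pg)).
  by apply: pnat_dvd p'GP; rewrite order_dvdn gm1.
have nsKG : 'ker V <| G by apply: ker_normal.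
have p'K : p^'.-group ('ker V).
  have := Hall_setI_normal nsKG sylP.
  have -> : P :&: 'ker V = 1 by rewrite -injV.
  by case/and3P=> _ _; rewrite indexg1.
have hallK : p^'.-Hall(G) ('ker V).
  rewrite /pHall normal_sub // p'K pnatNK -card_quotient ?normal_norm //.
  rewrite (card_isog (first_isog V)).
  apply: (pnat_dvd _ pP).
  have <- : #|idm_morphism P @* P| = #|P| by rewrite morphim_idm.
  rewrite -(card_injm (injm_fmod abA) (subxx _)) cardSg //.
  apply/subsetP=> u _; rewrite -(fmvalK u) mem_morphim //; exact: fmodP.
by rewrite (normal_Hall_pcore hallK nsKG).
Qed.

End Burnside.

(** * Abelian Sylow subgroups for the smallest prime divisor *)

Section SmallestPrime.

Implicit Types gT : finGroupType.

Lemma pi_Sylow_sub gT (G H : {group gT}) :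
    H \subset G ->
    (forall s, s \in \pi(G) ->
       exists2 S : {group gT}, s.-Sylow(G) S & S \subset H) ->
  H = G.
Proof.
move=> sHG sylH; apply/val_inj/eqP; rewrite eqEsubset sHG /=.
pose SS := [set S : {group gT} | (S \subset G) && (S \subset H)].
rewrite -(@Sylow_transversal_gen _ SS G).
- by rewrite gen_subG; apply/bigcupsP=> S /[!inE] /andP[].
- by move=> S /[!inE] /andP[].
move=> s /sylH[S sylS sSH]; exists S => //.
by rewrite inE sSH (pHall_sub sylS).
Qed.

(** In a coprime action on an abelian group P, [P, A] meets the centraliser of A trivially. *)
Lemma abelian_coprime_comm_cent gT (P A : {group gT}) :
    abelian P -> A \subset 'N(P) -> coprime #|P| #|A| ->
    [~: P, A] \subset 'C(A) ->
  A \subset 'C(P).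
Proof.
move=> abP nPA coPA cPAA; rewrite centsC; apply/commG1P.
by rewrite -(coprime_abel_cent_TI nPA coPA abP); apply/esym/setIidPl.
Qed.

(** All nontrivial subgroups of R share the same subgroup of order s. If [R, A] were nontrivial it
    would contain this subgroup, which A centralises as part of U, against coprime action. *)
Lemma cyclic_pgroup_faithful_sub gT (s : nat) (R A U : {group gT}) :
    cyclic R -> s.-group R -> A \subset 'N(R) -> coprime #|R| #|A| ->
    U \subset R -> U :!=: 1 -> A \subset 'C(U) ->
  A \subset 'C(R).
Proof.
move=> cycR sR nRA coRA sUR ntU cUA.
have abR := cyclic_abelian cycR.
have tiR := coprime_abel_cent_TI nRA coRA abR.
have sRAR : [~: R, A] \subset R by rewrite commg_subl.
have ntR : R :!=: 1 by apply: contraNneq ntU => R1; rewrite -subG1 -R1.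
have OhmR (W : {group gT}) : W \subset R -> W :!=: 1 -> 'Ohm_1(W) = 'Ohm_1(R).
  move=> sWR ntW; apply/eqP; rewrite eqEcard OhmS //=.
  rewrite (Ohm1_cyclic_pgroup_prime cycR sR ntR).
  by rewrite (Ohm1_cyclic_pgroup_prime (cyclicS sWR cycR) (pgroupS sWR sR) ntW).
rewrite centsC; apply/commG1P/eqP/negPn/negP => ntRA.
have eU := OhmR U sUR ntU; have eRA := OhmR [~: R, A]%G sRAR ntRA.
case/eqP: ntU; apply/eqP.
rewrite -Ohm1_eq1 eU -subG1 -tiR subsetI /= -{1}eRA -eU.
by rewrite Ohm_sub (subset_trans (Ohm_sub 1 U)) // centsC.
Qed.

(** The totient of a nontrivial power of p is a power of p times p - 1, with no prime factor above
    p. *)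
Lemma coprime_gt_totient gT p (C : {group gT}) m : prime p ->
  p.-group C -> (gt_pred p).-nat m -> coprime m (totient #|C|).
Proof.
move=> p_pr pC gtm.
case: (eqsVneq C 1) => [->|ntC]; first by rewrite cards1 coprimen1.
have [_ _ [k oC]] := pgroup_pdiv pC ntC.
apply: (pnat_coprime gtm); rewrite oC totient_pfactor // pnatM.
apply/andP; split.
  apply/pnatP => [|q q_pr]; first by rewrite -subn1 subn_gt0 prime_gt1.
  move/dvdn_leq; rewrite -subn1 subn_gt0 prime_gt1 // => /(_ isT) leq1.
  by rewrite !inE -leqNgt (leq_trans leq1) ?leq_subr.
by rewrite pnatX pnatE // !inE ltnn.
Qed.

(* P acts on R through its action on the subgroup of order s, whose
   automorphism group is cyclic; the Sylow subgroup R itself may have a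
   non-cyclic automorphism group when s = 2. *)
Lemma cyclic_quotient_cent gT (s : nat) (R P : {group gT}) : prime s ->
    cyclic R -> s.-group R -> P \subset 'N(R) -> coprime #|R| #|P| ->
  cyclic (P / 'C_P(R)).
Proof.
move=> s_pr cycR sR nRP coRP.
case: (eqsVneq R 1) => [R1|ntR].
  by rewrite (setIidPl _) ?trivg_quotient ?cyclic1 // R1 cents1.
pose U := 'Ohm_1(R)%G.
have sUR : U \subset R := Ohm_sub 1 R.
have nUP : P \subset 'N(U) := char_norm_trans (Ohm_char 1 R) nRP.
have ntU : U :!=: 1 by rewrite Ohm1_eq1.
have -> : 'C_P(R) = 'C_P(U).
  apply/eqP; rewrite eqEsubset setIS ?centS //= subsetI subsetIl /=.
  apply: (cyclic_pgroup_faithful_sub cycR sR _ _ sUR ntU).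
  - by rewrite subIset ?nRP.
  - by apply: coprimegS coRP; apply: subsetIl.
  exact: subsetIr.
have cycAU : cyclic (Aut U).
  by rewrite Aut_prime_cyclic // (Ohm1_cyclic_pgroup_prime cycR sR ntR).
rewrite -ker_conj_aut (isog_cyclic (first_isog_loc (conj_aut_morphism U) nUP)).
exact: cyclicS (Aut_conj_aut _ _) cycAU.
Qed.

Lemma cyclic_quotient_comm gT p (P K Y : {group gT}) : prime p ->
    p.-group P -> Y \subset 'N(P) -> Y \subset 'N(K) -> K <| P ->
    (gt_pred p).-group Y -> cyclic (P / K) ->
  [~: P, Y] \subset K.
Proof.
move=> p_pr pP nPY nKY /andP[sKP nKP] gtY cycPK.
rewrite -quotient_cents2 // centsC; apply: cyclic_coprime_cent => //.
  exact: quotient_norms.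
apply: coprime_gt_totient p_pr _ _; first exact: quotient_pgroup.
exact: quotient_pgroup.
Qed.

(** Weak enough to pass to quotients and to centralisers of elements of an abelian Sylow p-subgroup
    P, hence suited to induction on |G|. *)
Definition tame_action gT p (G P : {group gT}) :=
  forall s, s \in \pi(G) -> s != p ->
  exists2 R : {group gT}, s.-Sylow(G) R
    & (R \subset 'C(P)) || (cyclic R && (P \subset 'N(R))).

Lemma tame_action_quotient gT p (G P Z : {group gT}) :
  Z <| G -> P \subset G -> tame_action p G P -> tame_action p (G / Z) (P / Z).
Proof.
move=> /andP[sZG nZG] sPG tameP s s_G ne_sp.
have s_Gp : s \in \pi(G).
  by apply: pi_of_dvd s_G; rewrite /= ?cardG_gt0 ?dvdn_morphim.
have [R sylR tameR] := tameP s s_Gp ne_sp.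
have nZR := subset_trans (pHall_sub sylR) nZG.
exists (R / Z)%G; first exact: quotient_pHall.
case/orP: tameR => [cPR|/andP[cycR nRP]]; first by rewrite quotient_cents.
by rewrite quotient_cyclic //= quotient_norms // orbT.
Qed.

(** When R is cyclic it need not centralise a, but a conjugate of R under N_G(P) does. A Sylow
    s-subgroup of C_G(a) is moved to a nontrivial U inside R; a conjugate of a then lies in P and
    centralises U, hence all of R, and fusion in P is controlled by N_G(P). *)
Lemma tame_action_cent1 gT p (G P : {group gT}) a :
    p.-Sylow(G) P -> abelian P -> a \in P ->
  tame_action p G P -> tame_action p 'C_G[a] P.
Proof.
move=> sylP abP Pa tameP s s_C ne_sp; have [sPG pP _] := and3P sylP.
have sCG : 'C_G[a] \subset G := subsetIl _ _.
have sPC : P \subset 'C_G[a] by rewrite subsetI sPG sub_cent1 (subsetP abP).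
have s_G : s \in \pi(G) by apply: pi_of_dvd s_C; rewrite /= ?cardG_gt0 ?cardSg.
have [R sylR tameR] := tameP s s_G ne_sp.
have [sRG sR _] := and3P sylR.
case/orP: tameR => [cPR|/andP[cycR nRP]].
  exists R; last by rewrite cPR.
  apply: pHall_subl (sylR) => //.
  by rewrite subsetI sRG sub_cent1 (subsetP _ _ Pa) // centsC.
have s_pr : prime s by have := s_C; rewrite mem_primes => /and3P[].
have [S sylS] := Sylow_exists s 'C_G[a].
have [sSC sS _] := and3P sylS.
have ntS : S :!=: 1.
  by rewrite -cardG_gt1 (card_Hall sylS) p_part_gt1.
have [g Gg sSR] := Sylow_Jsub sylR (subset_trans sSC sCG) sS.
pose U := (S :^ g)%G.
have ntU : U :!=: 1 by rewrite -cardG_gt1 cardJg cardG_gt1.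
have chU : U \char R.
  by have [x defR] := cyclicP cycR; rewrite defR cycle_subgroup_char -?defR.
have nUP : P \subset 'N(U) := char_norm_trans chU nRP.
have sylPN : p.-Sylow('N_G(U)) P.
  by apply: pHall_subl (subsetIl _ _) (sylP); rewrite subsetI sPG.
have nsCN : 'C_G(U) <| 'N_G(U).
  by rewrite /normal setIS ?cent_sub //= normsI ?norms_cent ?subsetIr //
    subIset ?normG.
have sylPC := Hall_setI_normal nsCN sylPN.
have Cag : a ^ g \in 'C_G(U).
  rewrite inE groupJ ?(subsetP sPG a) //= centJ memJ_conjg.
  by rewrite -sub_cent1 (subset_trans sSC) ?subsetIr.
have pag : p.-group <[a ^ g]>.
  by rewrite /pgroup -orderE orderJ; apply: mem_p_elt pP Pa.
have [|h /setIP[Gh cUh]] := Sylow_Jsub sylPC _ pag; first by rewrite cycle_subG.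
rewrite -cycleJ cycle_subG -conjgM => /setIP[Pb /setIP[_ cUb]].
have [w /setIP[Gw nPw] def_aw] :=
  abelian_Sylow_fusion sylP abP Pa Pb (groupM Gg Gh).
have cRb : a ^ w \in 'C(R).
  rewrite def_aw -cycle_subG.
  apply: (@cyclic_pgroup_faithful_sub _ s R _ U) => //.
  - by rewrite cycle_subG (subsetP nRP).
  - apply: coprimegS (_ : coprime #|R| #|P|); first by rewrite cycle_subG.
    by apply: (pnat_coprime sR); apply: pi_pnat pP _; rewrite !inE eq_sym.
  by rewrite cycle_subG.
(* As w normalises P, this conjugate of R is still P-invariant. *)
exists (R :^ w^-1)%G; last first.
  by rewrite cyclicJ cycR /= normJ -sub_conjg (normP nPw) nRP orbT.
apply: pHall_subl (_ : s.-Sylow(G) _) => //; last by rewrite pHallJ ?groupV.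
rewrite subsetI sub_conjgV (subset_trans sRG) /=; last by rewrite conjGid.
by rewrite sub_conjgV -cent1J sub_cent1.
Qed.

(* The conjugates of K by Y meet the elementary abelian group of order p^2 in
   at least p + 1 lines, hence in all of them. *)
Lemma conjugate_lines_cover gT (p : nat) (P K Y : {group gT}) : prime p ->
    p.-group P -> abelian P -> K \subset P -> cyclic (P / K) ->
    Y \subset 'N(P) -> (gt_pred p).-group Y ->
    (exists2 y, y \in Y & K :&: K :^ y = 1 /\ K :^ y <> K) ->
  exists a, [/\ a \in K, a != 1
    & forall L : {group gT}, L \subset P -> cyclic (P / L) ->
        exists2 z, z \in Y & a ^ z \in L].
Proof.
move=> p_pr pP abP sKP cycPK nPY gtY [y Yy [tiKKy neKKy]].
pose E := 'Ohm_1(P)%G.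
have abelE : p.-abelem E := Ohm1_abelem pP abP.
have pE := abelem_pgroup abelE.
have sEP : E \subset P := Ohm_sub 1 P.
have nEY : Y \subset 'N(E) := char_norm_trans (Ohm_char 1 P) nPY.
(* A subgroup with cyclic quotient meets E in a subgroup of index at most p. *)
have log_line (L : {group gT}) : L \subset P -> cyclic (P / L) ->
    logn p #|E| <= (logn p #|E :&: L|).+1.
  move=> sLP cycPL.
  have nLE : E \subset 'N(L).
    exact: subset_trans sEP (sub_abelian_norm abP sLP).
  have cycE : cyclic (E / (L :&: E)).
    by rewrite (isog_cyclic (second_isog nLE)) (cyclicS _ cycPL) ?quotientS.
  have := abelem_cyclic (quotient_abelem (L :&: E) abelE); rewrite cycE.
  have nLEE : E \subset 'N(L :&: E).
    exact: sub_abelian_norm (abelem_abelian abelE) (subsetIr _ _).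
  rewrite card_quotient // => /esym.
  rewrite -(Lagrange (subsetIr L E)) lognM ?cardG_gt0 // => le1.
  by rewrite [E :&: L]setIC (leq_trans (leq_add (leqnn _) le1)) ?addn1.
pose L := (E :&: K)%G.
have pL : p.-group L := pgroupS (subsetIl _ _) pE.
have ntK : K :!=: 1.
  by apply/eqP=> K1; case: neKKy; rewrite K1 conjs1g.
have ntL : L :!=: 1.
  apply: contraNneq ntK => L1; apply/eqP.
  rewrite -(setIidPl sKP); apply: TI_Ohm1; by rewrite setIC.
have sLyE : L :^ y \subset E.
  by rewrite -(normsP nEY y Yy) conjSg subsetIl.
have tiLLy : L :&: L :^ y = 1.
  apply/trivgP; rewrite -tiKKy setISS ?subsetIr //.
  by rewrite conjSg subsetIr.
have logL_gt0 : 0 < logn p #|L|.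
  by have [pr_p /dvdn_leq _ [k ->]] := pgroup_pdiv pL ntL; rewrite pfactorK.
(* E contains the direct product of L and its conjugate; with [log_line] this forces |L| = p and |E|
   = p^2. *)
have logE_ge : (logn p #|L|).*2 <= logn p #|E|.
  rewrite -addnn -{2}(cardJg L y) -lognM ?cardG_gt0 //=.
  rewrite -TI_cardMg // dvdn_leq_log ?cardG_gt0 //.
  have cLLy : L \subset 'C(L :^ y).
    apply: subset_trans (subsetIl _ _) _.
    rewrite (subset_trans (abelem_abelian abelE)) ?centS //.
  by rewrite -cent_joinEr 1?centsC // cardSg // join_subG subsetIl sLyE.
have logL : logn p #|L| = 1%N.
  have := leq_trans logE_ge (log_line K sKP cycPK).
  rewrite /= -addnn -[X in _ <= X]addn1 leq_add2l => leL1.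
  by apply/eqP; rewrite eqn_leq leL1.
have logE : logn p #|E| = 2.
  apply/eqP; rewrite eqn_leq; move: (log_line K sKP cycPK) logE_ge.
  by rewrite -/L logL => -> ->.
have p2E : E \in 'E_p^2(P) by apply/pnElemP; split.
have p1L : L \in 'E_p^1(E).
  by apply/pnElemP; split; rewrite ?subsetIl ?(abelemS (subsetIl _ _) abelE).
(* The orbit of L is not a single point and its length divides |Y|, whose prime divisors exceed p; E
   has only p + 1 lines. *)
have orbL : orbit 'JG Y L = 'E_p^1(E).
  have sOE : orbit 'JG Y L \subset 'E_p^1(E).
    apply/subsetP=> _ /imsetP[z Yz ->].
    rewrite -(normsP nEY z Yz); by rewrite pnElemJ.
  apply/eqP; rewrite eqEcard sOE (card_p1Elem_p2Elem p2E) card_orbit astab1JG.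
  have : #|Y : 'N_Y(L)| != 1%N.
    rewrite indexg_eq1; apply: contraTN logL_gt0 => sYN.
    have nLy : L :^ y = L by apply/normP; case/setIP: (subsetP sYN y Yy).
    by move: tiLLy; rewrite nLy setIid => ->; rewrite cards1 logn1.
  have /pnatP : (gt_pred p).-nat #|Y : 'N_Y(L)| by apply: pnat_dvd
    (dvdn_indexg _ _) gtY.
  move=> /(_ (indexg_gt0 _ _)) gtI ne1.
  have := gtI _ (pdiv_prime _) (pdiv_dvd _).
  rewrite inE => /(_ _) lt; apply: leq_trans (lt _) (pdiv_leq _) => //.
  by rewrite ltn_neqAle eq_sym ne1 indexg_gt0.
have [a La nta] := trivgPn _ ntL.
exists a; split=> //; first by case/setIP: La.
move=> M sMP cycPM; pose EM := (E :&: M)%G.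
have logEM := log_line M sMP cycPM; rewrite logE ltnS in logEM.
have ntEM : EM :!=: 1 by apply: contraTneq logEM => ->; rewrite cards1 logn1.
have pEM : p.-group EM := pgroupS (subsetIl _ _) pE.
have [_ p_EM _] := pgroup_pdiv pEM ntEM.
have [b EMb ob] := Cauchy p_pr p_EM.
have p1b : <[b]>%G \in 'E_p^1(E).
  apply/pnElemP; split; first by rewrite cycle_subG; case/setIP: EMb.
    by apply: abelemS abelE; rewrite cycle_subG; case/setIP: EMb.
  by rewrite -orderE ob logn_prime ?eqxx.
move: p1b; rewrite -orbL => /imsetP[z Yz /(congr1 val) /= defb].
exists z => //.
have : a ^ z \in <[b]> by rewrite defb memJ_conjg.
by apply: subsetP; rewrite cycle_subG; case/setIP: EMb.
Qed.

(** The p-part of an element of N_G(P) lies in the abelian group P, so Burnside's condition need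
    only be tested on p'-elements. *)
Lemma p'elt_normal_complement gT p (G P : {group gT}) :
    p.-Sylow(G) P -> abelian P ->
    (forall y, y \in 'N_G(P) -> p^'.-elt y -> y \in 'C(P)) ->
  p^'.-Hall(G) 'O_p^'(G).
Proof.
move=> sylP abP cPY; have [sPG pP _] := and3P sylP.
apply: (Burnside_normal_complement sylP).
apply/subsetP=> x NPx; rewrite -(consttC p x) groupM //; last first.
  by rewrite cPY ?p_elt_constt ?groupX.
apply: (subsetP abP); rewrite -cycle_subG.
have sylPN : p.-Sylow('N_G(P)) P by rewrite Sylow_subnorm.
have nsPN : P <| 'N_G(P) by rewrite /normal subsetI sPG normG subsetIr.
rewrite (sub_normal_Hall sylPN) ?p_elt_constt ?cycle_subG ?groupX //.
exact: p_elt_constt.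
Qed.

Lemma p'group_gt_pred gT p (G A : {group gT}) : prime p ->
    (forall s, s \in \pi(G) -> p <= s) -> A \subset G -> p^'.-group A ->
  (gt_pred p).-group A.
Proof.
move=> p_pr min_p sAG p'A; apply/pgroupP=> q q_pr q_A.
have := pgroupP p'A q q_pr q_A.
rewrite !inE ltn_neqAle eq_sym => ->.
rewrite min_p // mem_primes q_pr cardG_gt0.
exact: dvdn_trans q_A (cardSg sAG).
Qed.

(* By induction the proper centralisers C_G(a), a in P, have a normal
   p-complement; the P-invariant Sylow subgroups R and R^y, which both lie in
   the complement of C_G(a) for a in C_P(R) and C_P(R^y), are then conjugate
   under C(P), so that C_P(R) is normalised by N_G(P). *)
Lemma smallest_prime_complement gT p (G P : {group gT}) :
    prime p -> (forall s, s \in \pi(G) -> p <= s) ->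
    p.-Sylow(G) P -> abelian P -> tame_action p G P ->
  p^'.-Hall(G) 'O_p^'(G).
Proof.
move=> p_pr; have [n] := ubnP #|G|; elim: n gT G P => // n IHn gT G P ltGn.
move=> min_p sylP abP tameP; have [sPG pP _] := and3P sylP.
have solP := abelian_sol abP.
have coP_p' (A : {group gT}) : p^'.-group A -> coprime #|P| #|A|.
  exact: pnat_coprime pP.
apply: (p'elt_normal_complement sylP abP) => y /setIP[Gy nPy] p'y.
pose Y := <[y]>%G.
have nPY : Y \subset 'N(P) by rewrite cycle_subG.
have gtY : (gt_pred p).-group Y.
  by apply: (p'group_gt_pred p_pr min_p); rewrite ?cycle_subG.
have coPY := coP_p' Y p'y.
have cPYZ : [~: P, Y] \subset 'Z(G) -> y \in 'C(P).
  move=> sRZ; rewrite -cycle_subG; apply: abelian_coprime_comm_cent => //.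
  apply: subset_trans sRZ (subset_trans (subsetIr G _) (centS _)).
  by rewrite cycle_subG.
pose Z := (P :&: 'Z(G))%G.
(* If Z is nontrivial, induction puts the image of Y in the normal p-complement of G / Z; its
   commutator with P / Z lies in both groups, hence is trivial. *)
case: (eqsVneq Z 1) => [tiPZ|ntZ]; last first.
  have nsZG : Z <| G.
    by apply: sub_center_normal; apply: subsetIr.
  have [sZG nZG] := andP nsZG.
  have hallO : p^'.-Hall(G / Z) 'O_p^'(G / Z).
    apply: (IHn _ _ (P / Z)%G).
    - by rewrite (leq_trans (ltn_quotient _ _)).
    - move=> s s_GZ; apply: min_p.
      apply: pi_of_dvd s_GZ; rewrite /= ?cardG_gt0 //.
      by rewrite dvdn_morphim.
    - by rewrite quotient_pHall // (subset_trans sPG).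
    - exact: quotient_abelian.
    exact: tame_action_quotient.
  apply: cPYZ; apply: subset_trans (subsetIr P _); rewrite -/Z.
  have nZP := subset_trans sPG nZG.
  have nZY : Y \subset 'N(Z) by rewrite cycle_subG (subsetP nZG).
  rewrite -quotient_cents2 //; apply/commG1P/trivgP.
  have sYO : Y / Z \subset 'O_p^'(G / Z).
    by rewrite (sub_Hall_pcore hallO) ?quotientS ?quotient_pgroup // cycle_subG.
  have tiPO : 'O_p^'(G / Z) :&: (P / Z) = 1.
    apply: coprime_TIg; rewrite coprime_sym.
    apply: pnat_coprime (quotient_pgroup _ pP) (pcore_pgroup _ _).
  rewrite -tiPO subsetI commg_subl quotient_norms // andbT.
  apply: subset_trans (commgS _ sYO) _.
  by rewrite commg_subr (subset_trans (quotientS _ sPG)) ?gFnorm.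
have central_trivial a : a \in P -> a != 1 ->
    (forall s, s \in \pi(G) ->
       exists2 S : {group gT}, s.-Sylow(G) S & S \subset 'C[a]) ->
  False.
  move=> Pa nta full; case/eqP: nta; apply/set1P.
  rewrite -set1gE -tiPZ inE Pa /=.
  have /setIidPl sGC: G :&: 'C[a] = G.
    apply: congr_group; apply: pi_Sylow_sub (subsetIl _ _) _ =>
      s /full[S sylS cSa].
    by exists S; rewrite // subsetI (pHall_sub sylS).
  by rewrite inE (subsetP sPG) // -sub_cent1.
have Hall_cent a : a \in P -> a != 1 -> p^'.-Hall('C_G[a]) 'O_p^'('C_G[a]).
  move=> Pa nta; apply: (IHn _ _ P).
  - apply: leq_trans (proper_card _) ltGn; rewrite properEneq subsetIl andbT.
    apply/eqP=> /setIidPl sGC; case: (central_trivial a Pa nta) => s _.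
    have [S sylS] := Sylow_exists s G; exists S => //.
    exact: subset_trans (pHall_sub sylS) sGC.
  - move=> s s_C; apply: min_p; apply: pi_of_dvd s_C; rewrite /= ?cardG_gt0 //.
    by rewrite cardSg ?subsetIl.
  - apply: pHall_subl (subsetIl _ _) (sylP).
    by rewrite subsetI sPG sub_cent1 (subsetP abP).
  - exact: abP.
  exact: tame_action_cent1.
have normK s (R : {group gT}) : s \in \pi(G) -> s != p -> s.-Sylow(G) R ->
    cyclic R -> P \subset 'N(R) -> y \in 'N('C_P(R)).
  move=> s_G ne_sp sylR cycR nRP; set K := 'C_P(R).
  have [sRG sR _] := and3P sylR.
  have s_pr : prime s by have := s_G; rewrite mem_primes => /and3P[].
  have p's : s \in p^' by rewrite !inE.
  have coRP : coprime #|R| #|P|.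
    by rewrite coprime_sym coP_p' // (pi_pgroup sR).
  have nKy : K :&: K :^ y != 1 -> K :^ y = K.
    case/trivgPn=> a /setIP[Ka Kya] nta; have [Pa cRa] := setIP Ka.
    have cRya : a \in 'C(R :^ y).
      by move: Kya; rewrite /= /K conjIg -centJ => /setIP[].
    have hallO := Hall_cent a Pa nta; set O := 'O_p^'('C_G[a]) in hallO.
    have sPC : P \subset 'C_G[a] by rewrite subsetI sPG sub_cent1 (subsetP abP).
    have nOP : P \subset 'N(O) := subset_trans sPC (gFnorm _ _).
    have sylO (S : {group gT}) : s.-Sylow(G) S -> a \in 'C(S) -> s.-Sylow(O) S.
      move=> sylS cSa; have [sSG sS _] := and3P sylS.
      apply: pHall_subl (subset_trans (pHall_sub hallO) (subsetIl _ _)) sylS.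
      rewrite (sub_Hall_pcore hallO) ?(pi_pgroup sS) //.
      by rewrite subsetI sSG sub_cent1.
    have sylRO := sylO R sylR cRa.
    have sylRyO : s.-Sylow(O) (R :^ y)%G by apply: sylO; rewrite ?pHallJ.
    have nRyP : P \subset 'N(R :^ y) by rewrite normJ -(normP nPy) conjSg.
    have coOP : coprime #|O| #|P|.
      by rewrite coprime_sym coP_p' // pcore_pgroup.
    have trO := sol_coprime_Sylow_trans s solP nOP coOP.
    have fixR : R \in [set S in 'Syl_s(O) | P \subset 'N(S)].
      by rewrite !inE sylRO.
    have fixRy : (R :^ y)%G \in [set S in 'Syl_s(O) | P \subset 'N(S)].
      by rewrite !inE sylRyO.
    have [c /setIP[_ cPc] /(congr1 val) /= defRy] := atransP2 trO fixR fixRy.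
    rewrite /K conjIg (normP nPy) -centJ defRy centJ.
    rewrite -{1}(normP (subsetP (cent_sub P) c cPc)) -conjIg.
    by apply/normP; rewrite (subsetP (cent_sub _)) // (subsetP (centS
      (subsetIl _ _)) c).
  (* If K meets its conjugate trivially and differs from it, there is a nontrivial a in K some
     Y-conjugate of which lies in C_P(S) for each cyclic S given by [tameP]; a would then be central
     in G. *)
  apply/normP; case: (eqVneq (K :&: K :^ y) 1) => [tiKKy|/nKy//].
  apply/eqP/negPn/negP=> /eqP neKKy.
  have [] := @conjugate_lines_cover _ p P 'C_P(R)%G Y p_pr pP abP _ _ nPY gtY.
  - exact: subsetIl.
  - exact: (cyclic_quotient_cent s_pr).
  - by exists y; rewrite ?cycle_id.
  move=> a [/setIP[Pa _] nta lines]; apply: (central_trivial a Pa nta) => q q_G.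
  have [->|ne_qp] := eqVneq q p.
    by exists P; rewrite // sub_cent1 (subsetP abP).
  have [S sylS tameS] := tameP q q_G ne_qp; have [sSG sS _] := and3P sylS.
  case/orP: tameS => [cPS|/andP[cycS nSP]].
    by exists S; rewrite // sub_cent1 (subsetP _ a Pa) // centsC.
  have q_pr : prime q by have := q_G; rewrite mem_primes => /and3P[].
  have [||z Yz /setIP[_ cSaz]] := lines 'C_P(S)%G.
  - exact: subsetIl.
  - apply: (cyclic_quotient_cent q_pr) => //; rewrite coprime_sym coP_p' //.
    by rewrite (pi_pgroup sS) // !inE.
  have Gz : z \in G by apply: (subsetP _ z Yz); rewrite cycle_subG.
  exists (S :^ z^-1)%G; first by rewrite pHallJ ?groupV.
  by rewrite sub_conjgV -cent1J sub_cent1.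
(* Y acts trivially on each cyclic quotient P / C_P(R), so [P, Y] centralises every R, and its
   elements are central in G. *)
apply: cPYZ; have sRP : [~: P, Y] \subset P by rewrite commg_subl.
have sRK s (R : {group gT}) : s \in \pi(G) -> s != p -> s.-Sylow(G) R ->
    cyclic R -> P \subset 'N(R) -> [~: P, Y] \subset 'C(R).
  move=> s_G ne_sp sylR cycR nRP; have [sRG sR _] := and3P sylR.
  have s_pr : prime s by have := s_G; rewrite mem_primes => /and3P[].
  apply: subset_trans (subsetIr P _).
  apply: (cyclic_quotient_comm p_pr pP nPY _ _ gtY).
  - by rewrite cycle_subG (normK s).
  - by rewrite /normal subsetIl (sub_abelian_norm abP) ?subsetIl.
  apply: (cyclic_quotient_cent s_pr) => //; rewrite coprime_sym coP_p' //.
  by rewrite (pi_pgroup sR) // !inE.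
apply/subsetP=> a Ra; have Pa := subsetP sRP a Ra.
have [-> //|nta] := eqVneq a 1.
case: (central_trivial a Pa nta) => s s_G.
have [->|ne_sp] := eqVneq s p.
  by exists P; rewrite // sub_cent1 (subsetP abP).
have [R sylR tameR] := tameP s s_G ne_sp.
exists R; rewrite // sub_cent1; case/orP: tameR => [cPR|/andP[cycR nRP]].
  by rewrite (subsetP _ a Pa) // centsC.
by rewrite (subsetP (sRK s R _ _ _ _ _)).
Qed.

End SmallestPrime.

(** * Perfect normal subgroups and Frattini subgroups of Hall subgroups *)

Section HallFrattini.

Variables (gT : finGroupType) (G N H : {group gT}).
Hypotheses (nsNG : N <| G) (perfN : N^`(1) = N) (sHG : H \subset G).
Hypotheses (solH : solvable H).
Hypotheses (coHiG : coprime #|H| #|G : H|) (sDPhi : N :&: H \subset 'Phi(H)).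

Let D := (N :&: H)%G.
Let E := D^`(1)%G.
Let sDH : D \subset H. Proof. exact: subsetIr. Qed.
Let sDN : D \subset N. Proof. exact: subsetIl. Qed.
Let nNH : H \subset 'N(N).
Proof. exact: subset_trans sHG (normal_norm nsNG). Qed.
Let nEH : H \subset 'N(E).
Proof.
by apply: (char_norm_trans (der_char 1 D)); rewrite normsI ?normG.
Qed.

Local Notation rT := (gT * coset_of E)%type.

(* The fibre product of N H and H / E over H / D. *)
Let fibre : {set rT} :=
  [set z : rT | [exists h in H, (z.1 \in N :* h) && (z.2 == coset E h)]].

Let fibreP (z : rT) :
  reflect (exists h, [/\ h \in H, z.1 \in N :* h & z.2 = coset E h])
          (z \in fibre).
Proof.
rewrite inE; apply: (iffP existsP) => -[h].
  by case/and3P=> Hh Nz /eqP zE; exists h.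
by case=> Hh Nz zE; exists h; rewrite Hh Nz zE eqxx.
Qed.

Fact fibre_group_set : group_set fibre.
Proof.
apply/group_setP; split=> [|x y /fibreP[h [Hh Nx xE]] /fibreP[k [Hk Ny yE]]].
  by apply/fibreP; exists 1; split; rewrite ?morph1 ?rcoset1 ?group1.
apply/fibreP; exists (h * k); rewrite groupM //=.
rewrite -rcoset_mul ?(subsetP nNH) // mem_mulg //; split=> //.
by rewrite xE yE morphM ?(subsetP nEH).
Qed.
Let F := Group fibre_group_set.

Let K := (F :&: 'ker (@fst gT (coset_of E)))%G.
Let FH := (F :&: (@fst gT (coset_of E)) @*^-1 H)%G.

Let memF h : h \in H -> (h, coset E h) \in F.
Proof. by move=> Hh; apply/fibreP; exists h; rewrite rcoset_refl. Qed.

Let memN n : n \in N -> (n, 1) \in F.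
Proof.
by move=> Nn; apply/fibreP; exists 1; split; rewrite ?morph1 ?rcoset1 ?group1.
Qed.

Let KP (z : rT) :
  reflect (z.1 = 1 /\ exists2 d, d \in D & z.2 = coset E d) (z \in K).
Proof.
apply: (iffP setIP) => [[/fibreP[h [Hh]]] | [z1 [d Dd z2]]].
  case: z => z1 z2 /= Nz zE /kerP /= z1E.
  rewrite z1E ?in_setT // in Nz *; split=> //.
  exists h => //; rewrite inE Hh andbT -groupV.
  by move: Nz; rewrite mem_rcoset mul1g.
split; last by apply/kerP; rewrite ?in_setT.
apply/fibreP; exists d; rewrite z2 z1 mem_rcoset mul1g groupV.
by rewrite (subsetP sDH) ?(subsetP sDN).
Qed.

(** The kernel K of the first projection of the fibre product is a copy of the abelian group D / E.
    Over H it is complemented by the pairs (h, hE), so by Gaschutz's theorem it has a complement L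
    in F. Then L contains N x 1 since N is perfect, and L projects onto H / E since D lies in
    Phi(H). This forces D = E, and a soluble perfect group is trivial. *)
Lemma Hall_Frattini_TI : N :&: H = 1.
Proof.
have nsKF : K <| F.
  rewrite /normal subsetIl normsI ?normG //.
  by rewrite (subset_trans (subsetT F)) ?ker_norm.
have sKFH : K \subset FH.
  apply/subsetP=> z Kz; have [z1 _] := KP z Kz.
  rewrite inE (subsetP (subsetIl _ _) z Kz) mem_morphpre ?in_setT //=.
  by rewrite z1 group1.
have sFHF : FH \subset F := subsetIl _ _.
have abK : abelian K.
  apply/centsP=> x /KP[x1 [d Dd x2]] y /KP[y1 [e De y2]].
  case: x y x1 x2 y1 y2 => x1 x2 [y1 y2] /= -> -> -> ->.
  rewrite /commute; congr (_, _).
  exact: (centsP (der_abelian 0 D)) (mem_quotient _ Dd) _ (mem_quotient _ De).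
have fstF : (@fst gT (coset_of E)) @* F \subset G.
  apply/subsetP=> _ /morphimP[z _ /fibreP[h [Hh Nz _]] ->].
  case/rcosetP: Nz => n Nn /= ->.
  by rewrite groupM ?(subsetP sHG h) ?(subsetP (normal_sub nsNG) n).
have fstFH : (@fst gT (coset_of E)) @* FH = H.
  apply/setP=> h; apply/morphimP/idP =>
    [[z _ /setIP[_ /morphpreP[_ Hz]] ->] | Hh] //.
  by exists (h, coset E h);
    rewrite ?in_setT // inE memF // mem_morphpre ?in_setT.
have coKF : coprime #|K| #|F : FH|.
  have oK : #|K| %| #|H|.
    have sKX : K \subset setX 1 (D / E).
      apply/subsetP=> -[z1 z2] /KP[/= -> [d Dd ->]].
      by rewrite inE /= group1 mem_quotient.
    apply: dvdn_trans (cardSg sKX) _; rewrite cardsX cards1 mul1n.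
    exact: dvdn_trans (dvdn_morphim _ _) (cardSg sDH).
  apply: coprime_dvdl oK _; apply: coprime_dvdr coHiG.
  have <- := index_morphim_ker (fst_morphism gT (coset_of E)) sFHF (subsetT F).
  have -> : #|'ker_F (@fst gT (coset_of E)) : FH| = 1%N.
    by apply/eqP; rewrite indexg_eq1.
  rewrite muln1 fstFH indexSg //.
  by rewrite -fstFH morphimS.
have splitFH : [splits FH, over K].
  pose delta x : rT := (x, coset E x).
  have deltaM : {in H &, {morph delta : x y / x * y}}.
    by move=> x y Hx Hy; rewrite /delta morphM ?(subsetP nEH).
  apply/splitsP; exists (Morphism deltaM @* H)%G; apply/complP; split.
    apply/trivgP/subsetP=> z /setIP[/KP[h1 _] /morphimP[h _ Hh zE]].
    by move: h1; rewrite zE /= => ->; rewrite inE /delta morph1.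
  apply/eqP; rewrite eqEsubset mul_subG //=; last first.
    apply/subsetP=> _ /morphimP[h _ Hh ->]; rewrite inE memF //.
    by rewrite mem_morphpre ?in_setT.
  apply/subsetP=> z /setIP[/fibreP[h [Hh Nz z2]]] /morphpreP[_ /= Hz].
  apply/mulsgP; exists (z * (delta z.1)^-1) (delta z.1); last by rewrite mulgKV.
    apply/KP; split; first by rewrite /= mulgV.
    exists (h * z.1^-1); last first.
      by rewrite /= z2 morphM ?morphV ?groupV ?(subsetP nEH).
    apply/setIP; split; last by rewrite groupM ?groupV.
    rewrite -groupV invMg invgK.
    by move: Nz; rewrite mem_rcoset.
  by apply/morphimP; exists z.1.
have /splitsP[L /complP[tiKL defF]] : [splits F, over K].
  by rewrite (Gaschutz_split nsKF sKFH sFHF).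
have sLF : L \subset F by rewrite -defF mulG_subr.
have lift z : z \in F -> exists2 d, d \in D & (z.1, coset E d * z.2) \in L.
  rewrite -{1}defF => /mulsgP[k l /KP[k1 [d Dd k2]] Ll ->].
  exists d^-1; rewrite ?groupV // morphV ?(subsetP nEH) ?(subsetP sDH) //.
  by rewrite /= k1 k2 mul1g mulKg; case: l Ll.
(* Second components in D / E commute, so the commutator of two lifts to L is ([x, y], 1). *)
have LN n : n \in N -> (n, 1) \in L.
  pose M := (@pairg1 gT (coset_of E) @*^-1 L)%G.
  suff sNM : N \subset M by move/(subsetP sNM)/morphpreP=> [].
  rewrite -perfN gen_subG; apply/subsetP=> _ /imset2P[x y Nx Ny ->].
  have [d Dd Lx] := lift (x, 1) (memN Nx).
  have [e De Ly] := lift (y, 1) (memN Ny).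
  rewrite mem_morphpre ?in_setT //=; move: Lx Ly; rewrite /= !mulg1 => Lx Ly.
  have := groupR Lx Ly.
  rewrite (_ : [~ _, _] = ([~ x, y], 1)) //.
  have /commgP/eqP <- : commute (coset E d) (coset E e).
    exact: (centsP (der_abelian 0 D)) (mem_quotient E Dd) _ (mem_quotient E De).
  by [].
(* T collects the elements of H whose image in H / E occurs as a second component in L. It
   supplements D in H, and D consists of nongenerators, so T = H. *)
have sDE : D \subset E.
  pose T := (H :&: coset E @*^-1 (@snd gT (coset_of E) @* L))%G.
  have memT h : h \in H -> (exists2 l, l \in L & l.2 = coset E h) -> h \in T.
    move=> Hh [l Ll lh]; rewrite inE Hh mem_morphpre ?(subsetP nEH) //= -lh.
    by apply/morphimP; exists l; rewrite ?in_setT.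
  have defT : <<T>> = H.
    apply: Phi_nongen; apply/eqP.
    rewrite eqEsubset join_subG Phi_sub subsetIl /=.
    apply/subsetP=> h Hh; have [d Dd Lh] := lift _ (memF Hh).
    have Hd := subsetP sDH d Dd.
    have Tdh : d * h \in T.
      apply: memT; first by rewrite groupM.
      by exists (h, coset E d * coset E h); rewrite //= morphM ?(subsetP nEH).
    rewrite -(mulKg d h) groupM //; last by rewrite mem_gen // inE Tdh orbT.
    by rewrite groupV mem_gen // inE (subsetP sDPhi).
  rewrite genGid in defT.
  apply/subsetP=> d Dd; have Hd := subsetP sDH d Dd.
  have Td : d \in T by rewrite defT.
  have /morphpreP[_ /= /morphimP[[g u] _ Ll /= du]] :=
    subsetP (subsetIr _ _) d Td.
  have /fibreP[h [Hh /= Ng uh]] := subsetP sLF _ Ll.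
  have {}uh : u = coset E h := uh; have {}du : coset E d = u := du.
  have Dh : h \in D.
    have nsED : E <| D := der_normal 1 D.
    have Dq : coset E h \in D / E by rewrite -uh -du mem_quotient.
    by rewrite -(quotientGK nsED); apply/morphpreP; rewrite (subsetP nEH).
  have Lg : (g, 1) \in L.
    apply: LN; case/rcosetP: Ng => n Nn ->.
    by rewrite groupM // (subsetP sDN).
  have : (g, 1)^-1 * (g, u) \in K :&: L.
    apply/setIP; split; last by rewrite groupM ?groupV.
    apply/KP; split; first by rewrite /= mulVg.
    by exists d; rewrite //= invg1 mul1g -du.
  rewrite tiKL => /set1P/(congr1 snd) /=; rewrite invg1 mul1g => u1.
  by rewrite -(ker_coset E); apply/kerP; rewrite ?(subsetP nEH) //= -?u1.
have [D1|ntD] := eqsVneq D 1; first exact: D1.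
have := sol_der1_proper solH sDH ntD.
by rewrite properE sDE andbF.
Qed.
End HallFrattini.

(** * Families of Hall subgroups *)

Section Families.

Implicit Types gT : finGroupType.

Lemma maximal_not_sub gT (H N : {group gT}) :
    N \subset H -> ~~ (N \subset 'Phi(H)) ->
  exists2 M : {group gT}, maximal M H & ~~ (N \subset M).
Proof.
move=> sNH not_sNPhi.
case: (pickP (fun M : {group gT} => maximal M H && ~~ (N \subset M))) =>
  [M /andP[]|noM].
  by exists M.
case/negP: not_sNPhi; apply/bigcapsP=> M /predU1P[/val_inj-> //|maxM].
by have := noM M; rewrite /= maxM /= => /negbFE.
Qed.

(** The partition is reduced to pairwise coprime orders covering pi(G). In this form the hypothesis
    passes to quotients, where several members may become trivial and coincide, and to products of
    some of the members. *)
Definition Hall_family gT (G : {group gT}) (HH : {set {group gT}}) :=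
  [/\ forall H : {group gT}, H \in HH -> Hall G H /\ supersoluble H,
      {in HH &, forall H K : {group gT}, H != K -> coprime #|H| #|K|},
      forall p, p \in \pi(G) -> exists2 H : {group gT}, H \in HH & p \in \pi(H)
    & {in HH &, forall H K : {group gT}, ~~ cyclic H -> K != H ->
        forall M : {group gT}, maximal M H -> M * K = K * M}].

(** A noncyclic group is the union of its maximal subgroups, and those of H permute with K. *)
Lemma noncyclic_permutes gT (G : {group gT}) (HH : {set {group gT}}) :
    Hall_family G HH ->
  {in HH &, forall H K : {group gT}, ~~ cyclic H -> H * K = K * H}.
Proof.
case=> _ _ _ maxHH H K hH hK ncH.
have [->//|neKH] := eqVneq K H.
suff sHK : H * K \subset K * H.
  by apply/eqP; rewrite eqEcard sHK -(card_invg (K * H)) invMG leqnn.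
apply/subsetP=> _ /mulsgP[h k Hh Kk ->].
have sxH : <[h]>%G \subset H by rewrite cycle_subG.
have [eqH|] := maximal_exists sxH.
  by case/negP: ncH; rewrite -eqH cycle_cyclic.
case=> M maxM sxM; have sMH := proper_sub (maxgroupp maxM).
have: h * k \in M * K by rewrite mem_mulg // -cycle_subG.
by rewrite (maxHH H K) //; apply: subsetP; rewrite mulgS.
Qed.

Lemma Hall_family_quotient gT (G C : {group gT}) (HH : {set {group gT}}) :
  C <| G -> Hall_family G HH -> Hall_family (G / C) [set (H / C)%G | H :
    {group gT} in HH].
Proof.
move=> nsCG [HallHH coHH piHH maxHH]; have [sCG nCG] := andP nsCG.
have nCH (H : {group gT}) : H \in HH -> H \subset 'N(C).
  by case/HallHH=> /andP[sHG _] _; apply: subset_trans nCG.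
split.
- move=> _ /imsetP[H hH ->]; have [hallH ssH] := HallHH H hH; split.
    exact: morphim_Hall (nCH H hH) hallH.
  exact: supersoluble_quotient (nCH H hH) ssH.
- move=> _ _ /imsetP[H hH ->] /imsetP[K hK ->] neHK.
  apply: coprime_morph; apply: coHH => //.
  by apply: contraNneq neHK => ->.
- move=> p p_GC; have p_G : p \in \pi(G).
    by apply: pi_of_dvd p_GC; rewrite /= ?cardG_gt0 ?dvdn_morphim.
  have [H hH p_H] := piHH p p_G; exists (H / C)%G; first exact: imset_f.
  have [hallH _] := HallHH H hH.
  have := quotient_pHall (nCH H hH) (Hall_pi hallH) => /card_Hall /= ->.
  by rewrite pi_of_part ?cardG_gt0 // inE /= p_GC.
move=> _ _ /imsetP[H hH ->] /imsetP[K hK ->] ncH neKH M maxM.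
have ncyH : ~~ cyclic H by apply: contra ncH; apply: quotient_cyclic.
have neKH' : K != H by apply: contraNneq neKH => ->.
(* Restricting the coset map to H makes the preimage M0 of M a subgroup of H, maximal there because
   M is maximal in the image. *)
pose f := restrm_morphism (nCH H hH) (coset_morphism C).
have sMf : M \subset f @* H.
  by rewrite morphim_restrm setIid; apply: proper_sub (maxgroupp maxM).
pose M0 := (f @*^-1 M)%G.
have sM0H : M0 \subset H by apply: subsetIl.
have defM : M :=: M0 / C.
  by rewrite -[LHS](morphpreK sMf) morphim_restrm (setIidPr sM0H).
have maxM0 : maximal M0 H.
  have defH : (f @*^-1 (f @* H))%G = H.
    apply/val_inj/eqP; rewrite eqEsubset subsetIl /=.
    by rewrite -sub_morphim_pre.
  suff: maximal M0 (f @*^-1 (f @* H))%G by rewrite defH.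
  by rewrite morphpre_maximal //= morphim_restrm setIid.
have nCM0 := subset_trans sM0H (nCH H hH).
rewrite defM -!quotientMl ?(nCH K) //.
by rewrite (maxHH H K).
Qed.

(** The last clause carries the induction; later it makes the product T permute with subgroups
    outside the list, such as a maximal subgroup of a member. *)
Lemma permuting_join gT (G : {group gT}) (S : seq {group gT}) :
    {in S &, forall H K : {group gT}, H * K = K * H} ->
    {in S, forall H : {group gT}, H \subset G} ->
  exists T : {group gT},
    [/\ T \subset G, {in S, forall H : {group gT}, H \subset T},
        forall p, p \in \pi(T) -> exists2 H : {group gT}, H \in S & p \in \pi(H)
      & forall L : {set gT}, {in S, forall H : {group gT}, L * H = H * L} ->
          L * T = T * L].
Proof.
elim: S => [|H S IHS] cS sSG.
  exists 1%G; split=> [||p|L _]; rewrite ?sub1G //; last by rewrite mulg1 mul1g.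
  by rewrite /= cards1.
have [|| T [sTG sST piT cT]] := IHS.
- by move=> K L SK SL; apply: cS; rewrite inE ?SK ?SL orbT.
- by move=> K SK; apply: sSG; rewrite inE SK orbT.
have cHT : H * T = T * H.
  by apply: cT => K SK; apply: cS; rewrite inE ?eqxx // SK orbT.
have defHT : H <*> T = H * T by apply: comm_joingE.
exists (H <*> T)%G; split.
- by rewrite join_subG sTG sSG ?mem_head.
- move=> K; rewrite inE => /predU1P[->|SK]; first exact: joing_subl.
  exact: subset_trans (sST K SK) (joing_subr _ _).
- move=> p; rewrite mem_primes /= => /and3P[p_pr _ p_HT].
  have: p %| #|H| * #|T| -> exists2 K : {group gT}, K \in H :: S & p \in \pi(K).
    rewrite Euclid_dvdM // => /orP[p_H | p_T].
      by exists H; rewrite ?mem_head // mem_primes p_pr cardG_gt0.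
    have [|K SK p_K] := piT p; first by rewrite mem_primes p_pr cardG_gt0.
    by exists K; rewrite // inE SK orbT.
  by rewrite mul_cardG -defHT; apply; apply: dvdn_mulr.
move=> L cL; rewrite /= defHT mulgA cL ?mem_head // -!mulgA; congr (_ * _).
by rewrite cT // => K SK; rewrite cL // inE SK orbT.
Qed.
End Families.

(** * The soluble case *)

Section Scalar.

Local Open Scope ring_scope.

(* Over F_p a matrix with A^p = A has an eigenvalue, so by Schur's lemma
   every element of G acts as a scalar. *)
Lemma minnormal_scalar_cyclic (gT : finGroupType) p (G N : {group gT}) :
    prime p ->
    minnormal N G -> (p.-abelem N)%g ->
    {in G &, forall x y, [~ x, y] \in 'C(N)}%g ->
    {in G, forall x, x ^+ p.-1 \in 'C(N)}%g ->
  cyclic N.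
Proof.
move=> p_pr minN abelN cNcomm cNexp; have /andP[ntN nNG] := mingroupp minN.
pose rG := abelem_repr abelN ntN nNG.
have irrG : mx_irreducible rG by apply/abelem_mx_irrP.
have rker1 x : x \in G -> x \in 'C(N)%g -> rG x = 1%:M.
  move=> Gx cNx; have : x \in rker rG by rewrite rker_abelem inE Gx.
  by case/rkerP.
have scalG x : x \in G -> exists a, rG x = a%:M.
  move=> Gx; pose A := rG x.
  have Ap : A ^+ p - A = 0.
    have -> : A ^+ p = A * A ^+ p.-1 by rewrite -exprS prednK ?prime_gt0.
    have := rker1 _ (groupX p.-1 Gx) (cNexp x Gx); rewrite repr_mxX // => ->.
    by apply/eqP; rewrite subr_eq0; apply/eqP; apply: mulmx1.
  (* X^p - X is the product of the X - a over all a in F_p, so some A - a is singular; it commutes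
     with the representation and vanishes by Schur's lemma. *)
  have prodA : \prod_(a : 'F_p) (A - a%:M) = 0.
    have := congr1 (horner_mx A) (finField_genPoly 'F_p).
    rewrite rmorphB rmorphXn /= horner_mx_X card_Fp // Ap rmorph_prod /= => ->.
    by apply: eq_bigr => a _; rewrite rmorphB /= horner_mx_X horner_mx_C.
  have [a Ua|unitA] := pickP (fun a : 'F_p => A - a%:M \notin unitmx).
    exists a; apply/eqP; rewrite -subr_eq0; apply: contraR Ua => ntA.
    apply: (mx_Schur irrG) ntA; apply/centgmxP=> y Gy.
    have cAy : A *m rG y = rG y *m A.
      rewrite -!repr_mxM // commgC (repr_mxM rG (groupM Gy Gx) (groupR Gx Gy)).
      by rewrite (rker1 _ (groupR Gx Gy)) ?cNcomm // mulmx1.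
    by rewrite mulmxBl mulmxBr cAy (scalar_mxC a (rG y)).
  have : \prod_(a : 'F_p) (A - a%:M) \is a GRing.unit.
    by apply: rpred_prod => a _; have := unitA a; move/negbFE.
  by rewrite prodA unitr0.
rewrite (abelem_cyclic abelN) -(dim_abelemE abelN ntN).
(* As G acts by scalars, the line spanned by this matrix of rank one is a submodule, and
   irreducibility makes it the whole space. *)
have [_ /(_ (delta_mx 0 0))] := (mx_irrP _).1 irrG.
rewrite /row_full mxrank_delta => /(_ _ _)/eqP <- //.
  apply/mxmoduleP=> x /scalG[a ->].
  by rewrite scalar_mxC mul_scalar_mx scalemx_sub.
by rewrite -mxrank_eq0 mxrank_delta.
Qed.
End Scalar.

(** * Commutators and (p - 1)-th powers acting on cyclic factors *)

Section Stability.

Implicit Types gT : finGroupType.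

(** The property shared by commutators and (p - 1)-th powers of elements of G; in a supersoluble G
    it makes the p'-part of z centralise every elementary abelian normal p-subgroup. *)
Definition cyclic_factor_central gT (G : {group gT}) p (z : gT) :=
  forall U W : {group gT}, U <| W -> G \subset 'N(U) -> G \subset 'N(W) ->
  cyclic (W / U) -> p.-abelem (W / U) -> coset U z \in 'C(W / U).

Lemma cyclic_factor_central_comm gT (G : {group gT}) p x y :
  x \in G -> y \in G -> cyclic_factor_central G p [~ x, y].
Proof.
move=> Gx Gy U W nsUW nUG nWG cycWU _.
have [Nx Ny] := (subsetP nUG x Gx, subsetP nUG y Gy).
apply: (subsetP (cyclic_der1_cent cycWU (quotient_norms U nWG))).
by rewrite /= morphR // mem_commg ?mem_quotient.
Qed.

(** A cyclic elementary abelian p-group has order 1 or p, so the order of its automorphism group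
    divides p - 1. *)
Lemma cyclic_factor_central_exp gT (G : {group gT}) p x : prime p ->
  x \in G -> cyclic_factor_central G p (x ^+ p.-1).
Proof.
move=> p_pr Gx U W nsUW nUG nWG cycWU abWU.
have Nx := subsetP nUG x Gx.
have nWx : coset U x \in 'N(W / U).
  by rewrite (subsetP (quotient_norms U nWG)) // mem_quotient.
rewrite morphX //= -ker_conj_aut; apply/kerP; first by rewrite groupX.
rewrite morphX //=; apply/eqP; rewrite -order_dvdn.
apply: dvdn_trans (order_dvdG (Aut_aut _ _)) _.
rewrite card_Aut_cyclic //.
have [k -> le1] : exists2 k, #|W / U| = (p ^ k)%N & k <= 1.
  exists (logn p #|W / U|); last by rewrite -(abelem_cyclic abWU).
  exact: card_pgroup (abelem_pgroup abWU).
case: k le1 => [|[|]] // _.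
by rewrite totient_pfactor // expn0 muln1.
Qed.

(** The series of G cut down to V has cyclic elementary abelian factors, which z and hence its
    p'-part centralise. A p'-element acting trivially on all factors of a series of a p-group acts
    trivially on the group. *)
Lemma supersoluble_abelem_cent gT p (G V : {group gT}) z :
    supersoluble G -> V <| G -> p.-abelem V -> z \in G ->
    cyclic_factor_central G p z ->
  z.`_p^' \in 'C(V).
Proof.
case=> s [ps ls] nsVG abelV Gz cent_z; have [sVG nVG] := andP nsVG.
have pV := abelem_pgroup abelV; set y := z.`_p^'.
have Gy : y \in G by rewrite groupX.
suff: y \in 'C(last 1%G s :&: V) by rewrite ls (setIidPr sVG).
elim/last_ind: s ps {ls} => [|s L IHs] /=; first by rewrite setI1g cent1T inE.
rewrite rcons_path last_rcons => /andP[/IHs]; set K := last _ _ => cyK.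
case/andP=> /and3P[nKG nLG nsKL] cKL.
have nsKLV : K :&: V <| L :&: V.
  have [sKL nKL] := andP nsKL.
  rewrite /normal setSI //= normsI //; first by rewrite subIset ?nKL.
  by rewrite subIset ?normG ?orbT.
have cycLV : cyclic ((L :&: V) / (K :&: V)).
  have [sKL nKL] := andP nsKL.
  have nKLV : L :&: V \subset 'N(K) by rewrite subIset ?nKL.
  have eqK : K :&: (L :&: V) = K :&: V by rewrite setIA (setIidPl sKL).
  rewrite /= -eqK (isog_cyclic (second_isog nKLV)).
  by rewrite (cyclicS _ cKL) ?quotientS ?subsetIl.
have abelLV : p.-abelem ((L :&: V) / (K :&: V)).
  by rewrite quotient_abelem // (abelemS (subsetIr _ _) abelV).
have nKV : G \subset 'N(K :&: V) by rewrite normsI.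
have nLV : G \subset 'N(L :&: V) by rewrite normsI.
have czF := cent_z (K :&: V)%G (L :&: V)%G nsKLV nKV nLV cycLV abelLV.
rewrite -cycle_subG; apply: abelian_coprime_comm_cent.
- exact: abelianS (subsetIr _ _) (abelem_abelian abelV).
- by rewrite cycle_subG (subsetP nLV).
- apply: (pnat_coprime (pgroupS (subsetIr _ _) pV)); exact: p_elt_constt.
apply: subset_trans (_ : K :&: V \subset _); last by rewrite centsC cycle_subG.
rewrite -quotient_cents2 ?cycle_subG ?(subsetP nKV) ?normal_norm //.
rewrite centsC quotient_cycle ?(subsetP nKV) // cycle_subG.
by rewrite morphX ?(subsetP nKV) // groupX.
Qed.

End Stability.

(** * Minimal normal subgroups of soluble groups with a Hall family *)

Section SolubleCase.

Implicit Types gT : finGroupType.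

Lemma Hall_family_gen gT (G D : {group gT}) (HH : {set {group gT}}) :
    Hall_family G HH -> (forall H : {group gT}, H \in HH -> H \subset D) ->
  G \subset D.
Proof.
case=> HallHH _ piHH _ sHD; apply/setIidPl.
apply: (congr1 val (_ : (G :&: D)%G = G)).
apply: pi_Sylow_sub (subsetIl _ _) _ => p /piHH[H hH p_H].
have [P sylP] := Sylow_exists p H; have [/Hall_pi hallH _] := HallHH H hH.
exists P; first exact: subHall_Sylow hallH p_H sylP.
rewrite subsetI (subset_trans (pHall_sub sylP) (pHall_sub hallH)).
exact: subset_trans (pHall_sub sylP) (sHD H hH).
Qed.

(** Let H = MN with M maximal in H. For another member K, a Sylow r-subgroup of M is one of MK, so
    it contains the normal r-subgroup in which MK meets N. Thus S is also the intersection of MK and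
    N, and K normalises it. Hence S is normal in G and trivial, and |N| is the prime |H : M|. *)
Lemma minnormal_not_Phi_cyclic gT (G N H : {group gT}) (HH : {set {group gT}})
  (r : nat) :
    Hall_family G HH -> minnormal N G -> N \subset G -> abelian N ->
    r.-group N ->
    H \in HH -> N \subset H -> ~~ (N \subset 'Phi(H)) ->
  cyclic N.
Proof.
move=> famG minN sNG abN rN hH sNH not_sNPhi.
have [HallHH coHH piHH maxHH] := famG.
have [/andP[ntN nNG] minN2] := mingroupP minN.
have [cycH|ncH] := boolP (cyclic H); first exact: cyclicS sNH cycH.
have [M maxM not_sNM] := maximal_not_sub sNH not_sNPhi.
have [hallH ssH] := HallHH H hH; have [sHG coHiG] := andP hallH.
have sMH := proper_sub (maxgroupp maxM).
have defH : M * N = H.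
  apply: maximal_mulg maxM sNH _ not_sNM.
  exact: subset_trans (subset_trans sMH sHG) nNG.
have prHM := supersoluble_maximal_index ssH maxM.
pose S := (M :&: N)%G.
have nSG : G \subset 'N(S).
  apply: (Hall_family_gen famG) => K hK.
  have [/val_inj->|neKH] := eqVneq (K : {set gT}) H.
    have nSN : N \subset 'N(S) by rewrite (sub_abelian_norm abN) ?subsetIr.
    have nMN := subset_trans (subset_trans sMH sHG) nNG.
    by rewrite -defH mul_subG // normsI ?normG.
  have cMK : M * K = K * M by apply: (maxHH H K).
  have [[hallK _] defMK] := (HallHH K hK, comm_joingE cMK).
  have sKG : K \subset G by case/andP: hallK.
  have [R sylR] := Sylow_exists r M.
  have coHK : coprime #|H| #|K| by apply: coHH => //; rewrite eq_sym.
  have sylR2 : r.-Sylow(M <*> K) R.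
    have [sRM rR r'MR] := and3P sylR.
    rewrite /pHall rR (subset_trans sRM (joing_subl _ _)) /=.
    rewrite -(Lagrange_index (joing_subl M K) sRM) pnatM r'MR andbT.
    have tiMK : M :&: K = 1 by rewrite coprime_TIg // (coprimeSg sMH).
    rewrite -divgS ?joing_subl //= defMK TI_cardMg // mulKn //.
    have [r_pr r_N _] := pgroup_pdiv rN ntN.
    rewrite p'natE //; apply/negP=> r_K.
    have : r %| gcdn #|H| #|K| by rewrite dvdn_gcd r_K (dvdn_trans r_N) ?cardSg.
    by rewrite (eqP coHK) dvdn1 => /eqP r1; rewrite r1 in r_pr.
  have sMKN : (M <*> K) :&: N \subset M.
    apply: subset_trans (pHall_sub sylR).
    apply: normal_sub_max_pgroup (Hall_max sylR2) (pgroupS (subsetIr _ _) rN) _.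
    rewrite /normal subsetIl normsI ?normG // (subset_trans _ nNG) //.
    by rewrite join_subG sKG (subset_trans sMH).
  have defS : M :&: N = (M <*> K) :&: N.
    by apply/eqP; rewrite eqEsubset setSI ?joing_subl // subsetI sMKN subsetIr.
  rewrite /S /= defS; apply: normsI; last exact: subset_trans sKG nNG.
  exact: subset_trans (joing_subr M K) (normG _).
have S1 : S :=: 1.
  apply: contraNeq not_sNM => ntS; rewrite -(minN2 S) ?subsetIl ?subsetIr //.
  by rewrite ntS.
apply: prime_cyclic.
by rewrite -(mulKn #|N| (cardG_gt0 M)) -TI_cardMg // defH divgS.
Qed.

Lemma soluble_Hall_family_supersoluble gT (G : {group gT})
  (HH : {set {group gT}}) :
    Hall_family G HH -> solvable G ->
    (forall C : {group gT}, C <| G -> C :!=: 1 -> supersoluble (G / C)%G) ->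
  supersoluble G.
Proof.
move=> famG solG ssGC; have [HallHH coHH piHH maxHH] := famG.
case: (eqsVneq G 1) => [|ntG]; first exact: supersoluble1.
have step (N : {group gT}) r : minnormal N G -> N <| G -> r \in \pi(N) ->
    supersoluble G \/ exists H : {group gT},
      [/\ H \in HH, N \subset H & N \subset 'Phi(H)].
  move=> minN nsNG r_N; have sNG := normal_sub nsNG.
  have [nNG ntN /is_abelemP[q q_pr abelN]] := minnormal_solvable minN sNG solG.
  have qN := abelem_pgroup abelN; have abN := abelem_abelian abelN.
  have q_N : q \in \pi(N).
    case: (pgroup_pdiv qN ntN) => _ q_N _.
    by rewrite mem_primes q_pr cardG_gt0.
  have [H hH q_H] := piHH q (piSg sNG q_N).
  have [/Hall_pi hallH _] := HallHH H hH.
  have sNH : N \subset H.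
    apply: subset_trans (pcore_sub_Hall hallH).
    by rewrite pcore_max // (pi_pgroup qN).
  have [sNPhi|not_sNPhi] := boolP (N \subset 'Phi(H)).
    by right; exists H.
  left; apply: (supersoluble_ext nsNG); last exact: ssGC.
  exact: minnormal_not_Phi_cyclic famG minN sNG abN qN hH sNH not_sNPhi.
(* By Dedekind's law N and the intersection of A and H generate H, and N consists of nongenerators
   of H. *)
have Phi_supp (N H A : {group gT}) : N <| G -> H \in HH -> N \subset H ->
    N \subset 'Phi(H) -> A \subset G -> N * A = G -> N \subset A.
  move=> nsNG hH sNH sNPhi sAG defG.
  have [/andP[sHG _] _] := HallHH H hH.
  have defH : <<A :&: H>> = H.
    apply: Phi_nongen; apply/eqP.
    rewrite eqEsubset join_subG Phi_sub subsetIr /=.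
    have : N * (A :&: H) = H.
      by rewrite group_modl // defG; apply/setIidPr.
    move=> {1}<-; rewrite mul_subG ?joing_subr //.
    exact: subset_trans sNPhi (joing_subl _ _).
  apply: subset_trans sNH _; rewrite -defH genGid; exact: subsetIl.
have exmin (C : {group gT}) : C <| G -> C :!=: 1 ->
    exists N : {group gT}, [/\ minnormal N G, N <| G, N \subset C & N :!=: 1].
  case/andP=> sCG nCG ntC.
  have [N minN sNC] : {N : {group gT} | minnormal N G & N \subset C}.
    by apply: mingroup_exists; rewrite ntC.
  have /andP[ntN nNG] := mingroupp minN.
  by exists N; split; rewrite // /normal (subset_trans sNC).
pose p := max_pdiv #|G|.
have gt1G : 1 < #|G| by rewrite cardG_gt1.
have p_pr : prime p by apply: max_pdiv_prime.
have p_G : p \in \pi(G) by rewrite mem_primes p_pr cardG_gt0 max_pdiv_dvd.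
have [P sylP] := Sylow_exists p G; have [sPG pP _] := and3P sylP.
have ntP : P :!=: 1 by rewrite -cardG_gt1 (card_Hall sylP) p_part_gt1.
have [N [minN nsNG sNG ntN]] := exmin G (normal_refl G) ntG.
have pi_pdiv_N : pdiv #|N| \in \pi(N) by rewrite pi_pdiv cardG_gt1.
have [//|[H [hH sNH sNPhi]]] := step N _ minN nsNG pi_pdiv_N.
have sylPN : p.-Sylow(G / N) (P / N).
  by rewrite quotient_pHall // (subset_trans sPG) ?normal_norm.
have nsPNq : P / N <| G / N.
  apply: (supersoluble_max_Sylow_normal p_pr _ (ssGC N nsNG ntN) sylPN).
  move=> q q_GN.
  apply: max_pdiv_max.
  by apply: pi_of_dvd q_GN; rewrite /= ?cardG_gt0 ?dvdn_morphim.
(* The Frattini argument makes N_G(P) a supplement of N, so it contains N and equals G. *)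
have nsPG : P <| G.
  have nNP := subset_trans sPG (normal_norm nsNG).
  pose L := (coset N @*^-1 (P / N))%G.
  have defL : L :=: N * P by apply: quotientK.
  have nsLG : L <| G by rewrite -[G in _ <| G](quotientGK nsNG) cosetpre_normal.
  have sylPL : p.-Sylow(L) P.
    by apply: pHall_subl (normal_sub nsLG) sylP; rewrite defL mulG_subr.
  have defG : N * 'N_G(P) = G.
    rewrite -[RHS](Frattini_arg nsLG sylPL) defL -mulgA; congr (_ * _).
    by rewrite mulSGid // subsetI sPG normG.
  have sNN := Phi_supp N H 'N_G(P)%G nsNG hH sNH sNPhi (subsetIl _ _) defG.
  rewrite /normal sPG -{1}defG mulSGid //; exact: subsetIr.
(* N is chosen afresh inside P, now that P is normal. *)
have {N minN nsNG sNG ntN pi_pdiv_N H hH sNH sNPhi sylPN nsPNq}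
  [N [minN nsNG sNP ntN]] := exmin P nsPG ntP.
have pN := pgroupS sNP pP.
have abelN : p.-abelem N.
  have [_ _ /is_abelemP[q q_pr abelN]] :=
    minnormal_solvable minN (normal_sub nsNG) solG.
  have [_ q_N _] := pgroup_pdiv (abelem_pgroup abelN) ntN.
  suff -> : p = q by [].
  by apply/eqP; rewrite eq_sym; apply: (pgroupP pN).
have p_N : p \in \pi(N).
  by have [_ p_dN _] := pgroup_pdiv pN ntN; rewrite mem_primes p_pr cardG_gt0.
have [//|[H [hH sNH sNPhi]]] := step N p minN nsNG p_N.
(* If Phi(P) = 1, N has a complement in the elementary abelian group P, hence one in G by Gaschutz's
   theorem, which [Phi_supp] forbids. *)
have [PhiP1|ntPhi] := eqVneq 'Phi(P) 1.
  have abelP : p.-abelem P by rewrite -trivg_Phi // PhiP1.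
  have /splitsP[L /complP[tiNL defG]] : [splits G, over N].
    rewrite (Gaschutz_split nsNG sNP sPG (abelem_abelian abelN))
      ?(abelem_splits abelP) //.
    by case/and3P: sylP => _ _ p'GP; apply: pnat_coprime pN p'GP.
  have sLG : L \subset G by rewrite -defG mulG_subr.
  case/eqP: ntN; rewrite -tiNL; apply/esym/setIidPl.
  exact: Phi_supp nsNG hH sNH sNPhi sLG defG.
have nsPhiG : 'Phi(P) <| G := char_normal_trans (Phi_char P) nsPG.
have ssPhi := ssGC 'Phi(P)%G nsPhiG ntPhi.
have [sPhiG nPhiG] := andP nsPhiG.
have sPhiP := Phi_sub P; have nPhiP := subset_trans sPG nPhiG.
(* N meets Z(P) nontrivially, and Z(P) is normal in G. *)
have cNP : P \subset 'C(N).
  have nsNP := normalS sNP sPG nsNG.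
  have [_ minN2] := mingroupP minN.
  rewrite centsC -(minN2 (N :&: 'Z(P))%G) ?subsetIl //=.
    exact: subset_trans (subsetIr _ _) (subsetIr _ _).
  rewrite meet_center_nil ?(pgroup_nil pP) //= normsI ?(normal_norm nsNG) //.
  exact: char_norm_trans (center_char P) (normal_norm nsPG).
(* The p-part of z lies in P and centralises N. The p'-part acts trivially on P / Phi(P); by coprime
   action its fixed points generate P modulo Phi(P), so they are all of P. *)
have cent z : z \in G ->
    cyclic_factor_central (G / 'Phi(P))%G p (coset 'Phi(P) z) -> z \in 'C(N).
  move=> Gz central_z; have Nz := subsetP nPhiG z Gz.
  rewrite -(consttC p z) groupM //.
    apply: (subsetP cNP).
    by rewrite (mem_normal_Hall sylP nsPG) ?p_elt_constt // groupX.
  set y := z.`_p^'; have Gy : y \in G by rewrite groupX.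
  have Ny := subsetP nPhiG y Gy.
  have cy : coset 'Phi(P) y \in 'C(P / 'Phi(P)).
    have -> : coset 'Phi(P) y = (coset 'Phi(P) z).`_p^'.
      exact: (morph_constt (coset_morphism _)).
    apply: (supersoluble_abelem_cent ssPhi _ _ _ central_z).
    - exact: quotient_normal.
    - exact: Phi_quotient_abelem.
    exact: mem_quotient.
  have nPy : <[y]> \subset 'N(P).
    by rewrite cycle_subG (subsetP (normal_norm nsPG)).
  have nPhiy : <[y]> \subset 'N('Phi(P)) by rewrite cycle_subG.
  have coPy : coprime #|P| #|<[y]>|.
    by apply: (pnat_coprime pP); apply: p_elt_constt.
  have := coprime_quotient_cent sPhiP nPhiy coPy (pgroup_sol pP).
  rewrite quotient_cycle // [RHS](setIidPl _);
    last by rewrite centsC cycle_subG.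
  move=> defCq; have defC : <<'C_P(<[y]>)>> = P.
    apply: Phi_nongen; apply/eqP; rewrite eqEsubset join_subG sPhiP subsetIl /=.
    rewrite -(quotientSGK nPhiP) ?joing_subl // quotientYidl ?defCq //.
    by rewrite subIset ?nPhiP.
  rewrite genGid in defC; apply: (subsetP (centS sNP)).
  rewrite -cycle_subG centsC -{1}defC; exact: subsetIr.
apply: (supersoluble_ext nsNG); last exact: ssGC.
apply: (minnormal_scalar_cyclic p_pr minN abelN) => [x y Gx Gy | x Gx].
  apply: cent; first exact: groupR.
  rewrite morphR ?(subsetP nPhiG) //=.
  by apply: cyclic_factor_central_comm; apply: mem_quotient.
apply: cent; first exact: groupX.
rewrite morphX ?(subsetP nPhiG) //=.
by apply: cyclic_factor_central_exp; rewrite ?mem_quotient.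
Qed.

End SolubleCase.

(** * The nonsoluble case *)

Section MinimalNormal.

Implicit Types gT : finGroupType.

(** The p'-elements of N_G(P) have orders with prime factors above p only, so they act trivially on
    the cyclic p-group P. *)
Lemma cyclic_smallest_complement gT p (G P : {group gT}) : prime p ->
    (forall s, s \in \pi(G) -> p <= s) -> p.-Sylow(G) P -> cyclic P ->
  p^'.-Hall(G) 'O_p^'(G).
Proof.
move=> p_pr min_p sylP cycP; have [sPG pP _] := and3P sylP.
apply: (p'elt_normal_complement sylP (cyclic_abelian cycP)) =>
  y /setIP[Gy nPy] p'y.
rewrite -cycle_subG; apply: cyclic_coprime_cent; rewrite ?cycle_subG //.
apply: (coprime_gt_totient p_pr pP).
by apply: (p'group_gt_pred p_pr min_p); rewrite ?cycle_subG.
Qed.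

(** The number of cosets of J fixed by A is congruent to l modulo q. If q > l, all are fixed; if q =
    l, the coset J is fixed, so the number is a positive multiple of l and again all are. The kernel
    of the action is the core of J. *)
Lemma prime_index_fix gT l q (G J A : {group gT}) : prime l -> prime q ->
    J \subset G -> #|G : J| = l -> gcore J G = 1 -> A \subset G -> q.-group A ->
    (l < q) || (q == l) && (A \subset J) ->
  A :=: 1.
Proof.
move=> l_pr q_pr sJG iGJ coreJ sAG qA lq; apply/trivgP.
rewrite -coreJ -astabRs_rcosets.
have actsA : [acts A, on rcosets J G | 'Rs] :=
  subset_trans sAG (actsRs_rcosets J G).
have := pgroup_fix_mod qA actsA; rewrite -/(#|G : J|) iGJ.
set F := 'Fix_(_ | _)(A) => modF.
have sF : F \subset rcosets J G := subsetIl _ _.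
have leF : #|F| <= l by rewrite -iGJ subset_leq_card.
have defF : F = rcosets J G.
  apply/eqP; rewrite eqEcard sF -/(#|G : J|) iGJ /=.
  case/orP: lq => [lt_lq|/andP[/eqP eql sAJ]].
    by rewrite -(modn_small lt_lq) modF modn_small // (leq_ltn_trans leF).
  have F_J : (J : {set gT}) \in F.
    apply/setIP; split; first by apply/rcosetsP; exists 1; rewrite ?rcoset1.
    by apply/afixP=> a Aa; rewrite /= rcosetE rcoset_id // (subsetP sAJ).
  apply: dvdn_leq; first by apply/card_gt0P; exists (J : {set gT}).
  by rewrite -eql /dvdn -modF eql modnn.
apply/subsetP=> a Aa; apply/astabP=> X.
by rewrite -defF => /setIP[_ /afixP]; apply.
Qed.

Section Nonsoluble.

Variables (gT : finGroupType) (G N : {group gT}).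
Hypotheses (minN : minnormal N G) (nsNG : N <| G) (nsolN : ~~ solvable N).

Lemma minnormal_char_eq (C : {group gT}) : C \char N -> C :!=: 1 -> C :=: N.
Proof.
move=> chC ntC; have [_ minN2] := mingroupP minN.
apply: minN2; last exact: char_sub.
by rewrite ntC (char_norm_trans chC) ?normal_norm.
Qed.

Lemma nonsoluble_minnormal_perfect : N^`(1) = N.
Proof.
apply: (minnormal_char_eq (der_char 1 N)).
by apply: contra nsolN => /eqP/derG1P; apply: abelian_sol.
Qed.

(** Being characteristic, the p'-core is 1 or N; as a Hall subgroup it would make N a p-group or a
    p'-group. *)
Lemma nonsoluble_minnormal_no_complement p :
  p \in \pi(N) -> ~~ p^'.-Hall(N) 'O_p^'(N).
Proof.
move=> p_N; apply/negP=> hallO.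
have [O1|ntO] := eqVneq 'O_p^'(N) 1.
  case/negP: nsolN; apply: (@pgroup_sol _ p); rewrite -pgroupNK -partG_eq1.
  by rewrite -(card_Hall hallO) /= O1 cards1.
have defO := minnormal_char_eq (pcore_char p^' N) ntO.
by have := pcore_pgroup p^' N; rewrite defO p'groupEpi p_N.
Qed.

Variable HH : {set {group gT}}.
Hypothesis famG : Hall_family G HH.
Hypothesis ssGC :
  forall C : {group gT}, C <| G -> C :!=: 1 -> supersoluble (G / C)%G.

(** By minimality the core meets N trivially, so N embeds in the quotient by the core, which is
    supersoluble if the core is nontrivial. *)
Lemma gcore_trivial (J : {group gT}) : J \subset G -> ~~ (N \subset J) ->
  gcore J G = 1.
Proof.
move=> sJG not_sNJ; apply/eqP/negPn/negP=> ntC; set C := gcore J G in ntC.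
have nsCG : C <| G := gcore_normal sJG.
have tiCN : C :&: N = 1.
  apply: contraNeq not_sNJ => ntCN.
  have [_ minN2] := mingroupP minN.
  have sCN : C :&: N \subset N := subsetIr _ _.
  rewrite -(minN2 (C :&: N)%G) //; first by rewrite subIset ?gcore_sub.
  by rewrite ntCN normsI ?normal_norm.
have nCN : N \subset 'N(C) := subset_trans (normal_sub nsNG) (normal_norm nsCG).
case/negP: nsolN; rewrite (isog_sol (quotient_isog nCN tiCN)).
apply: solvableS (quotientS C (normal_sub nsNG)) _.
exact: supersoluble_sol (ssGC nsCG ntC).
Qed.

Lemma nonsoluble_noncyclic_Sylow :
  exists2 p, p \in \pi(N) /\ (forall s, s \in \pi(N) -> p <= s)
    & forall P : {group gT}, p.-Sylow(N) P -> ~~ cyclic P.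
Proof.
have ntN : N :!=: 1 by apply: contraNneq nsolN => ->; apply: solvable1.
have p_N : pdiv #|N| \in \pi(N) by rewrite pi_pdiv cardG_gt1.
have min_p s : s \in \pi(N) -> pdiv #|N| <= s.
  by rewrite mem_primes => /and3P[s_pr _ s_N]; rewrite pdiv_min_dvd ?prime_gt1.
exists (pdiv #|N|); first by split.
move=> P sylP; apply: contra (nonsoluble_minnormal_no_complement p_N) => cycP.
by apply: cyclic_smallest_complement min_p sylP cycP; apply: pdiv_prime;
  rewrite cardG_gt1.
Qed.

Lemma permuting_family_contra :
  {in HH &, forall H K : {group gT}, H * K = K * H} -> False.
Proof.
move=> cHH; have [HallHH coHH piHH maxHH] := famG; have sNG := normal_sub nsNG.
have [p [p_N min_p] ncSyl] := nonsoluble_noncyclic_Sylow.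
have p_pr : prime p by move: p_N; rewrite mem_primes => /and3P[].
have [H hH p_H] := piHH p (piSg sNG p_N).
have [hallH ssH] := HallHH H hH; have [sHG coHiG] := andP hallH.
have solH := supersoluble_sol ssH.
have ncSylH (P : {group gT}) : p.-Sylow(H) P -> ~~ cyclic P.
  move=> sylP; have sylPG := subHall_Sylow (Hall_pi hallH) p_H sylP.
  apply: contra (ncSyl _ (Hall_setI_normal nsNG sylPG)) => cycP.
  exact: cyclicS (subsetIl _ _) cycP.
have ncH : ~~ cyclic H.
  have [P sylP] := Sylow_exists p H.
  by apply: contra (ncSylH P sylP); apply: cyclicS (pHall_sub sylP).
(* Otherwise [Hall_Frattini_TI] makes the Sylow p-subgroups of N trivial, hence cyclic. *)
have not_sNPhi : ~~ (N :&: H \subset 'Phi(H)).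
  apply/negP=> sNPhi.
  have tiNH := Hall_Frattini_TI nsNG nonsoluble_minnormal_perfect sHG solH
    coHiG sNPhi.
  have [P sylP] := Sylow_exists p H; case/negP: (ncSylH P sylP).
  have sylPG := subHall_Sylow (Hall_pi hallH) p_H sylP.
  have sylPN := Hall_setI_normal nsNG sylPG.
  case/negP: (ncSyl _ sylPN); suff PN1 : P :&: N = 1 by rewrite /= PN1 cyclic1.
  by apply/trivgP; rewrite -tiNH /= setIC setIS // (pHall_sub sylP).
have [M maxM not_sNM] :=
  @maximal_not_sub _ H (N :&: H)%G (subsetIr N H) not_sNPhi.
have sMH := proper_sub (maxgroupp maxM).
have l_pr := supersoluble_maximal_index ssH maxM; set l := #|H : M| in l_pr.
have [||T [sTG sST piT cT]] := @permuting_join gT G (enum (HH :\ H)).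
- move=> K L; rewrite !mem_enum => /setD1P[_ hK] /setD1P[_ hL]; exact: cHH.
- by move=> K; rewrite mem_enum => /setD1P[_ /HallHH[/andP[]]].
have cMT : M * T = T * M.
  apply: cT => K; rewrite mem_enum => /setD1P[neKH hK].
  exact: (maxHH H K).
have cHT : H * T = T * H.
  by apply: cT => K; rewrite mem_enum => /setD1P[neKH hK]; apply: cHH.
have coHT : coprime #|H| #|T|.
  rewrite coprime_pi' // /pgroup; apply/pnatP=> // q q_pr q_T.
  have [|K] := piT q; first by rewrite mem_primes q_pr cardG_gt0.
  rewrite mem_enum => /setD1P[neKH hK] q_K; apply/negP=> q_H.
  have := coHH H K hH hK; rewrite eq_sym neKH => /(_ isT).
  rewrite coprime_has_primes ?cardG_gt0 // => /hasPn/(_ q q_K).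
  by rewrite q_H.
have tiHT : H :&: T = 1 := coprime_TIg coHT.
have defG : H * T = G.
  apply/eqP; rewrite eqEsubset mul_subG //= -comm_joingE //.
  apply: (Hall_family_gen famG) => K hK; have [->|neKH] := eqVneq K H.
    exact: joing_subl.
  by rewrite (subset_trans (sST K _)) ?joing_subr // mem_enum !inE neKH.
(* H and T have coprime orders and product G, so J has index |H : M| = l in G and meets H in M
   only. *)
pose J := (M <*> T)%G; have defJ : J :=: M * T by apply: comm_joingE.
have sJG : J \subset G by rewrite join_subG (subset_trans sMH).
have tiMT : M :&: T = 1 by apply/trivgP; rewrite -tiHT setSI.
have iGJ : #|G : J| = l.
  rewrite -divgS // defJ -{1}defG !TI_cardMg // divnMr ?cardG_gt0 //.
  by rewrite divgS.
have not_sNJ : ~~ (N \subset J).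
  apply: contra not_sNM => sNJ.
  have -> : M :=: J :&: H.
    by rewrite defJ -group_modl // setIC tiHT mulg1.
  by rewrite setSI.
have coreJ := gcore_trivial sJG not_sNJ.
have fix1 q (A : {group gT}) : prime q -> A \subset G -> q.-group A ->
    (l < q) || (q == l) && (A \subset J) -> A :=: 1.
  by move=> q_pr; apply: prime_index_fix l_pr q_pr sJG iGJ coreJ.
have l_H : l %| #|H| by rewrite dvdn_indexg.
(* An element of H of prime order above l would fix every coset of J. *)
have max_l q : q \in \pi(H) -> q <= l.
  rewrite mem_primes => /and3P[q_pr _ /(Cauchy q_pr)[x Hx ox]].
  rewrite leqNgt; apply/negP=> lt_lq; have := fix1 q <[x]>%G q_pr.
  rewrite lt_lq cycle_subG (subsetP sHG) // /pgroup -orderE ox pnat_id //.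
  move=> /(_ isT isT isT) x1; move: ox; rewrite orderE x1 cards1 => q1.
  by rewrite -q1 in q_pr.
have [R sylR] := Sylow_exists l H; have [sRH lR _] := and3P sylR.
have sRG := subset_trans sRH sHG.
(* From this |R| is at most |G : J| = l. *)
have tiRJ : R :&: J = 1.
  apply: (fix1 l (R :&: J)%G l_pr); first by rewrite subIset ?sRG.
    exact: pgroupS (subsetIl _ _) lR.
  by rewrite eqxx subsetIr orbT.
have oR : #|R| = l.
  apply/eqP; rewrite eqn_leq; apply/andP; split.
    rewrite -(leq_pmul2r (cardG_gt0 J)) -TI_cardMg // -iGJ mulnC Lagrange //.
    by rewrite subset_leq_card // mul_subG.
  rewrite (card_Hall sylR) dvdn_leq //.
  by rewrite -{1}(part_pnat_id (pnat_id l_pr)) partn_dvd.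
have nsRH : R <| H := supersoluble_max_Sylow_normal l_pr max_l ssH sylR.
have defG2 : J * R = G.
  apply/eqP; rewrite eqEcard mul_subG //= TI_cardMg; last by rewrite setIC.
  by rewrite oR -iGJ Lagrange.
(* Since G = JR, an element of M centralising R lies in every conjugate of J. *)
have cMR : 'C_M(R) = 1.
  apply/trivgP; rewrite -coreJ; apply/subsetP=> m /setIP[Mm cRm].
  apply/bigcapP=> x; rewrite -defG2 => /mulsgP[j r Jj Rr ->].
  rewrite conjsgM (conjGid Jj) mem_conjg conjgE invgK mulgA.
  by rewrite -(centP cRm r Rr) mulgK (subsetP (joing_subl M T)).
have cycM : cyclic M.
  have nRM : M \subset 'N(R) := subset_trans sMH (normal_norm nsRH).
  rewrite (isog_cyclic (quotient1_isog M)) -cMR -ker_conj_aut.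
  rewrite (isog_cyclic (first_isog_loc (conj_aut_morphism R) nRM)).
  by apply: cyclicS (Aut_conj_aut _ _) _; rewrite Aut_prime_cyclic // oR.
have [P sylP] := Sylow_exists p H; case/negP: (ncSylH P sylP).
have [eq_pl|ne_pl] := eqVneq p l.
  rewrite eq_pl in sylP.
  rewrite prime_cyclic // (card_Hall sylP) -(card_Hall sylR) oR //.
have [Q sylQ] := Sylow_exists p M.
have sylQH : p.-Sylow(H) Q.
  have [sQM pQ p'MQ] := and3P sylQ.
  rewrite /pHall (subset_trans sQM) // pQ -(Lagrange_index sMH sQM).
  rewrite pnatM p'MQ andbT.
  by rewrite pnatE // !inE eq_sym.
have [x _ ->] := Sylow_trans sylQH sylP.
by rewrite cyclicJ (cyclicS (pHall_sub sylQ)).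
Qed.

End Nonsoluble.
End MinimalNormal.

(** * A subgroup of a nonabelian product of noncyclic members that all of G normalises *)

Section NonabelianCore.

Implicit Types gT : finGroupType.

Lemma coprime_normal_cents gT (G A B : {group gT}) :
  A <| G -> B <| G -> coprime #|A| #|B| -> A \subset 'C(B).
Proof.
move=> /andP[sAG nAG] /andP[sBG nBG] coAB.
apply/commG1P/trivgP; rewrite -(coprime_TIg coAB) subsetI commg_subl commg_subr.
by rewrite (subset_trans sAG) // (subset_trans sBG).
Qed.

(** G' is nilpotent, so its w-subgroups lie in its w-core, which is normal in G. *)
Lemma supersoluble_pi_der1_sub_pcore gT (G D : {group gT}) (w : nat) :
  supersoluble G -> D \subset G^`(1) -> w.-group D -> D \subset 'O_w(G).
Proof.
move=> ssG sDG' wD.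
apply: subset_trans (_ : D \subset 'O_w(G^`(1))) _.
  have hallw := nilpotent_pcore_Hall w (supersoluble_der1_nil ssG).
  by rewrite (sub_Hall_pcore hallw).
rewrite pcore_max ?pcore_pgroup //.
exact: char_normal_trans (pcore_char _ _) (der_normal 1 G).
Qed.

(* The derived subgroup of Y is nilpotent, hence centralises the abelian normal
   Sylow subgroup W. *)
Lemma supersoluble_commg_normal gT (Y W X : {group gT}) (w : nat) :
    supersoluble Y -> w.-Sylow(Y) W -> W <| Y -> abelian W -> X \subset Y ->
  Y \subset 'N([~: W, X]).
Proof.
move=> ssY sylW nsWY abW sXY; have [sWY wW _] := and3P sylW.
have nWY := normal_norm nsWY.
have cWY' : Y^`(1) \subset 'C(W).
  have nilY' := supersoluble_der1_nil ssY.
  have [_ defY' _ _] := dprodP (nilpotent_pcoreC w nilY').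
  rewrite -[Y^`(1)]defY' mul_subG //.
    apply: subset_trans _ abW.
    rewrite (sub_normal_Hall sylW nsWY) ?pcore_pgroup //.
    exact: subset_trans (pcore_sub _ _) (der_sub 1 Y).
  apply: (coprime_normal_cents _ nsWY).
    exact: char_normal_trans (pcore_char _ _) (der_normal 1 Y).
  by rewrite coprime_sym; apply: pnat_coprime wW (pcore_pgroup _ _).
apply/normsP=> g Yg; apply/eqP; rewrite eqEcard cardJg leqnn andbT.
rewrite conjsRg (normsP nWY) // gen_subG.
apply/subsetP=> _ /imset2P[x _ Wx /imsetP[z Xz ->] ->].
(* As z^g = z [z, g] and [z, g] centralises W, the commutators [x, z^g] and [x, z] agree. *)
have cx : [~ z, g] \in 'C(W).
  by rewrite (subsetP cWY') // mem_commg // (subsetP sXY).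
have -> : z ^ g = z * [~ z, g] by rewrite mulKVg.
have Wxz : [~ x, z] \in W.
  rewrite commgEl groupM ?groupV // memJ_norm //.
  by rewrite (subsetP nWY) ?(subsetP sXY).
rewrite commgMJ (_ : [~ x, [~ z, g]] = 1); last first.
  by apply/eqP/commgP; apply: commute_sym; apply: (centP cx).
rewrite mul1g conjgE -(centP cx _ Wxz) mulKg mem_commg //.
Qed.

(** T is a w'-group centralising D, so D is the normal Sylow w-subgroup of DT, and Y normalises
    DT. *)
Lemma pcore_gt_norm gT (Y D : {group gT}) (w : nat) :
    D \subset Y -> w.-group D -> 'O_(gt_pred w)(Y) \subset 'C(D) ->
    Y / 'O_(gt_pred w)(Y) \subset 'N(D / 'O_(gt_pred w)(Y)) ->
  Y \subset 'N(D).
Proof.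
set T := 'O_(gt_pred w)(Y)%G => sDY wD cTD nDY.
have w'T : w^'.-group T.
  apply: sub_pgroup (pcore_pgroup _ _) => q; rewrite !inE.
  by apply: contraTneq => ->; rewrite ltnn.
have nsTY : T <| Y := pcore_normal _ _; have nTY := normal_norm nsTY.
have nTD := subset_trans sDY nTY.
have nsDDT : D <| D <*> T.
  by rewrite /normal joing_subl join_subG normG cents_norm.
have sylD : w.-Sylow(D <*> T) D.
  rewrite /pHall joing_subl wD -divgS ?joing_subl //= norm_joinEl //.
  by rewrite coprime_cardMg ?mulKn // (pnat_coprime wD).
have nDTY : Y \subset 'N(D <*> T).
  rewrite joingC norm_joinEr // -quotientK //.
  by apply: subset_trans (morphpre_norm _ _); rewrite -sub_morphim_pre.
rewrite -(normal_Hall_pcore sylD nsDDT).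
exact: char_norm_trans (pcore_char _ _) nDTY.
Qed.

Lemma Sylow_quotient_pcore_gt_normal gT (Y W : {group gT}) (w : nat) :
    prime w ->
    supersoluble Y -> w.-Sylow(Y) W ->
  W / 'O_(gt_pred w)(Y) <| Y / 'O_(gt_pred w)(Y).
Proof.
set T := 'O_(gt_pred w)(Y)%G => w_pr ssY sylW.
have nTY : Y \subset 'N(T) := normal_norm (pcore_normal _ _).
have nTW := subset_trans (pHall_sub sylW) nTY.
apply: (supersoluble_max_Sylow_normal w_pr).
- move=> q; rewrite mem_primes => /and3P[q_pr _].
  rewrite /= card_quotient // => q_YT.
  have /and3P[_ _ le_w] := supersoluble_Hall_gt w ssY.
  by have := pnatP _ (indexg_gt0 Y T) le_w q q_pr q_YT; rewrite !inE -leqNgt.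
- exact: supersoluble_quotient.
exact: quotient_pHall.
Qed.

(** Let w be the largest prime for which a Sylow w-subgroup W of X is not central. The core of X for
    primes above w is central, so W is normal in X. Take D = [W, X] if W is abelian and D = W'
    otherwise. As D lies in Y', it is in the w-core of Y and commutes with the core for primes above
    w; modulo that core W is normal in Y and so is D. *)
Lemma supersoluble_nonabelian_core gT (X : {group gT}) (YY : {set {group gT}}) :
    supersoluble X -> ~~ abelian X ->
    (forall Y : {group gT}, Y \in YY -> supersoluble Y /\ Hall Y X) ->
  exists D : {group gT}, [/\ D \subset X, D :!=: 1, solvable D
    & forall Y : {group gT}, Y \in YY -> Y \subset 'N(D)].
Proof.
move=> ssX nabX hallX.
pose noncentral v :=
  [exists W : {group gT}, v.-Sylow(X) W && ~~ (W \subset 'C(X))].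
have central_sub (U : {group gT}) : U \subset X ->
    (forall s, s \in \pi(U) ->
       exists2 S : {group gT}, s.-Sylow(U) S & S \subset 'C(X)) ->
    U \subset 'C(X).
  move=> sUX cSyl; apply/setIidPl.
  apply: (congr1 val (_ : (U :&: 'C(X))%G = U)).
  apply: pi_Sylow_sub (subsetIl _ _) _ => s /cSyl[S sylS cS].
  by exists S; rewrite // subsetI (pHall_sub sylS).
have exw : exists v, noncentral v.
  case: (boolP (has noncentral (primes #|X|))) => [/hasP[v _]|/hasPn none].
    by exists v.
  case/negP: nabX; apply: central_sub => // s /none ncs.
  have [S sylS] := Sylow_exists s X; exists S => //; apply: contraR ncs => ncS.
  by apply/existsP; exists S; rewrite sylS.
have pi_noncentral v : noncentral v -> v \in \pi(X).
  case/existsP=> W /andP[sylW]; apply: contraR => v'X.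
  suff -> : W :=: 1 by apply: sub1G.
  by apply/eqP; rewrite trivg_card1 (card_Hall sylW) p_part_eq1.
have bound v : noncentral v -> v <= #|X|.
  by move/pi_noncentral; rewrite mem_primes => /and3P[_ X_gt0 /dvdn_leq->].
case: (ex_maxnP exw bound) => w ncw max_w.
have w_X := pi_noncentral w ncw; case/existsP: ncw => W /andP[sylW ncW].
have [sWX wW _] := and3P sylW.
have w_pr : prime w by move: w_X; rewrite mem_primes => /and3P[].
pose U := 'O_(gt_pred w)(X)%G.
have hallU : (gt_pred w).-Hall(X) U by apply: supersoluble_Hall_gt.
have cUX : U \subset 'C(X).
  apply: central_sub (pcore_sub _ _) _ => s s_U.
  have [S sylS] := Sylow_exists s U; exists S => //.
  have gts : s \in gt_pred w.
    move: s_U; rewrite mem_primes => /and3P[s_pr _].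
    exact: (pgroupP (pcore_pgroup _ _)).
  have sylSX := subHall_Sylow hallU gts sylS.
  apply: contraLR gts => ncS; rewrite !inE -leqNgt; apply: max_w.
  by apply/existsP; exists S; rewrite sylSX.
have nWX : X \subset 'N(W).
  apply: (@pcore_gt_norm _ X W w) => //;
    first exact: subset_trans cUX (centS sWX).
  exact: normal_norm (Sylow_quotient_pcore_gt_normal w_pr ssX sylW).
have norm_core (D : {group gT}) : D \subset W -> D \subset X^`(1) ->
    (forall Y : {group gT}, Y \in YY ->
       Y / 'O_(gt_pred w)(Y) \subset 'N(D / 'O_(gt_pred w)(Y))) ->
    forall Y : {group gT}, Y \in YY -> Y \subset 'N(D).
  move=> sDW sDX' nDT Y yY; have [ssY /andP[sXY _]] := hallX Y yY.
  have wD := pgroupS sDW wW.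
  have sDY' := subset_trans sDX' (dergS 1 sXY).
  have sDO := supersoluble_pi_der1_sub_pcore ssY sDY' wD.
  apply: (pcore_gt_norm _ wD _ (nDT Y yY)).
    exact: subset_trans sDW (subset_trans sWX sXY).
  apply: subset_trans (centS sDO).
  apply: coprime_normal_cents (pcore_normal _ _) (pcore_normal _ _) _.
  apply: pnat_coprime (pcore_pgroup _ _) _.
  apply: sub_pgroup (pcore_pgroup _ _).
  by move=> q /eqP ->; rewrite !inE ltnn.
have facts (Y : {group gT}) : Y \in YY -> [/\ supersoluble Y, X \subset Y,
    w.-Sylow(Y) W & Y \subset 'N('O_(gt_pred w)(Y))].
  move=> yY; have [ssY hallYX] := hallX Y yY; split=> //;
    first by case/andP: hallYX.
    exact: subHall_Sylow (Hall_pi hallYX) w_X sylW.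
  exact: normal_norm (pcore_normal _ _).
have solW (D : {group gT}) : D \subset W -> solvable D.
  by move=> sDW; apply: pgroup_sol (pgroupS sDW wW).
have [abW|nabW] := boolP (abelian W).
  have sDW : [~: W, X] \subset W by rewrite commg_subl.
  exists [~: W, X]%G; split.
  - exact: subset_trans sDW sWX.
  - by apply: contraNneq ncW => /commG1P.
  - exact: solW.
  apply: norm_core => // [|Y yY]; first exact: commSg.
  have [ssY sXY sylWY nTY] := facts Y yY.
  have nTX := subset_trans sXY nTY.
  rewrite /= quotientR ?(subset_trans sWX) //.
  apply: (@supersoluble_commg_normal _ (Y / _)%G (W / _)%G (X / _)%G w).
  - exact: supersoluble_quotient.
  - by rewrite quotient_pHall // (subset_trans sWX).
  - exact: Sylow_quotient_pcore_gt_normal.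
  - exact: quotient_abelian.
  exact: quotientS.
have sDW : W^`(1) \subset W := der_sub 1 W.
exists W^`(1)%G; split.
- exact: subset_trans sDW sWX.
- by apply: contraNneq nabW => /derG1P.
- exact: solW.
apply: norm_core => // [|Y yY]; first exact: dergS.
have [ssY sXY sylWY nTY] := facts Y yY.
rewrite /= quotient_der ?(subset_trans sWX) ?(subset_trans sXY) //.
apply: char_norm_trans (der_char 1 _) _.
by apply: normal_norm; apply: Sylow_quotient_pcore_gt_normal.
Qed.

End NonabelianCore.

(** * Families with two members that do not permute *)

Section NonPermuting.

Implicit Types gT : finGroupType.

Lemma nonpermuting_family_contra gT (G N : {group gT}) (HH : {set {group gT}}) :
    Hall_family G HH ->
    (forall (D : {group gT}) (KK : {set {group gT}}),
       D \proper G -> Hall_family D KK -> supersoluble D) ->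
    (forall C : {group gT}, C <| G -> solvable C -> C :=: 1) ->
    minnormal N G -> N <| G ->
    (exists2 H : {group gT}, H \in HH &
       exists2 K : {group gT}, K \in HH & H * K <> K * H) ->
  False.
Proof.
move=> famG IH nosol minN nsNG [H1 hH1 [K1 hK1 not_perm]].
have [HallHH coHH piHH maxHH] := famG; have sNG := normal_sub nsNG.
have ntN : N :!=: 1 by case/andP: (mingroupp minN).
have nsolN : ~~ solvable N.
  by apply: contra ntN => solN; apply/eqP/nosol.
have sHG (H : {group gT}) : H \in HH -> H \subset G by case/HallHH=> /andP[].
have pi_inj (H K : {group gT}) q : H \in HH -> K \in HH ->
    q \in \pi(H) -> q \in \pi(K) -> H = K.
  move=> hH hK q_H q_K; apply/eqP/negPn/negP=> neHK.
  have := coHH H K hH hK neHK; rewrite coprime_has_primes ?cardG_gt0 //.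
  by move/hasPn/(_ q q_K); rewrite q_H.
(* Noncyclic members permute with all others, so H1 and K1 are both cyclic. *)
have cycH1 : cyclic H1.
  apply: contraPT not_perm => ncH1.
  by move/(_ (noncyclic_permutes famG hH1 hK1 ncH1)).
have cycK1 : cyclic K1.
  apply: contraPT not_perm => ncK1.
  by move/(_ (esym (noncyclic_permutes famG hK1 hH1 ncK1))).
pose A := [set H in HH | ~~ cyclic H].
have sAHH (H : {group gT}) : H \in A -> H \in HH by case/setIdP.
have [||X [sXG sAX piX cX]] := @permuting_join gT G (enum A).
- move=> H K; rewrite !mem_enum => /setIdP[hH ncH] /sAHH hK.
  exact: (noncyclic_permutes famG hH hK ncH).
- by move=> H; rewrite mem_enum => /sAHH/sHG.
have cXb (b : {group gT}) : b \in HH -> X * b = b * X.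
  move=> hb; apply/esym/cX => H; rewrite mem_enum => /setIdP[hH ncH].
  by apply/esym; apply: (noncyclic_permutes famG hH hb ncH).
have piY (b : {group gT}) q : b \in HH -> q \in \pi(X <*> b) ->
    exists2 H : {group gT}, H \in b |: A & q \in \pi(H).
  move=> hb; rewrite mem_primes /= => /and3P[q_pr _ q_Y].
  have : q %| #|X| * #|b|.
    by rewrite mul_cardG -(comm_joingE (cXb b hb)) dvdn_mulr.
  rewrite Euclid_dvdM // => /orP[q_X|q_b]; last first.
    by exists b; rewrite ?setU11 // mem_primes q_pr cardG_gt0.
  have [|H] := piX q; first by rewrite mem_primes q_pr cardG_gt0.
  by rewrite mem_enum => hH q_H; exists H; rewrite // setU1r.
have sYG (b : {group gT}) : b \in HH -> X <*> b \subset G.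
  by move=> hb; rewrite join_subG sXG sHG.
have famY (b : {group gT}) : b \in HH -> Hall_family (X <*> b) (b |: A).
  move=> hb.
  have sHH (H : {group gT}) : H \in b |: A -> H \in HH.
    by case/setU1P=> [->|/sAHH].
  split.
  - move=> H bAH; have [/andP[_ coHG] ssH] := HallHH H (sHH H bAH); split=> //.
    have sHY : H \subset X <*> b.
      case/setU1P: bAH => [->|AH]; first exact: joing_subr.
      by rewrite (subset_trans (sAX H _)) ?mem_enum ?joing_subl.
    rewrite /Hall sHY (coprime_dvdr _ coHG) //.
    by rewrite -(Lagrange_index (sYG b hb) sHY) dvdn_mull.
  - by move=> H K /sHH hH /sHH hK; apply: coHH.
  - by move=> q; apply: piY.
  by move=> H K /sHH hH /sHH hK; apply: maxHH.
have ssY (b : {group gT}) : b \in HH -> cyclic b -> supersoluble (X <*> b)%G.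
  move=> hb cycb; apply: (IH _ (b |: A)) (famY b hb).
  rewrite properEneq sYG // andbT; apply/eqP=> defY.
  (* One of H1 and K1 differs from b, and neither is trivial since they do not permute. Being cyclic
     and different from b, it has order prime to those of b and of all members in A, so it cannot
     lie in the product of X and b. *)
  have [c hc [cycc ntc necb]] : exists2 c : {group gT}, c \in HH &
      [/\ cyclic c, c :!=: 1 & c != b].
    have [eqb|neb] := eqVneq H1 b; last first.
      exists H1; rewrite // cycH1 neb; split=> //.
      by apply: contraPneq not_perm => ->; rewrite mulg1 mul1g.
    exists K1; rewrite // cycK1 -eqb; split=> //.
      by apply: contraPneq not_perm => ->; rewrite mulg1 mul1g.
    by apply: contraPneq not_perm => ->.
  have q_c : pdiv #|c| \in \pi(c) by rewrite pi_pdiv cardG_gt1.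
  have q_Y : pdiv #|c| \in \pi(X <*> b) by rewrite defY (piSg (sHG c hc)).
  have [H bAH q_H] := piY b _ hb q_Y.
  have hH : H \in HH by case/setU1P: bAH => [->|/sAHH].
  have eqcH := pi_inj c H _ hc hH q_c q_H; rewrite -eqcH in bAH.
  by case/setU1P: bAH => [/eqP|]; rewrite ?(negPf necb) // inE cycc andbF.
have ssX : supersoluble X := supersolubleS (joing_subl X H1) (ssY H1 hH1 cycH1).
pose YY := [set (X <*> b)%G | b : {group gT} in [set b in HH | cyclic b]].
have genG (D : {group gT}) :
    (forall Y : {group gT}, Y \in YY -> Y \subset 'N(D)) -> G \subset 'N(D).
  move=> nYD; apply: (Hall_family_gen famG) => H hH.
  have nYb (b : {group gT}) : b \in HH -> cyclic b -> X <*> b \subset 'N(D).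
    by move=> hb cb; apply: (nYD (X <*> b)%G); apply: imset_f; rewrite inE hb.
  have [cycH|ncH] := boolP (cyclic H).
    exact: subset_trans (joing_subr _ _) (nYb H hH cycH).
  apply: subset_trans (nYb H1 hH1 cycH1); apply: subset_trans (joing_subl _ _).
  by apply: sAX; rewrite mem_enum inE hH.
have hallX : Hall G X.
  rewrite /Hall sXG coprime_pi' ?cardG_gt0 //.
  apply/pnatP=> // q q_pr q_GX; apply/negP=> q_X.
  have [H] := piX q q_X; rewrite mem_enum => AH q_H.
  have [/Hall_pi/and3P[sHG' _ pi'H] _] := HallHH H (sAHH H AH).
  have sHX : H \subset X by apply: sAX; rewrite mem_enum.
  have := pnatP _ (indexg_gt0 G H) pi'H q q_pr.
  rewrite -(Lagrange_index sXG sHX) dvdn_mulr // => /(_ isT).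
  by rewrite inE /= q_H.
have abX : abelian X.
  apply/negPn/negP=> nabX.
  have [|D [sDX ntD solD nYD]] := @supersoluble_nonabelian_core _ X YY ssX nabX.
    move=> _ /imsetP[b /setIdP[hb cycb] ->]; split; first exact: ssY.
    have [_ coXG] := andP hallX.
    rewrite /Hall joing_subl (coprime_dvdr _ coXG) //.
    by rewrite -(Lagrange_index (sYG b hb) (joing_subl X b)) dvdn_mull.
  case/eqP: ntD; apply: nosol solD.
  by rewrite /normal (subset_trans sDX) // genG.
have [p [p_N min_p] ncSyl] := nonsoluble_noncyclic_Sylow minN nsNG nsolN.
have p_pr : prime p by move: p_N; rewrite mem_primes => /and3P[].
case/negP: (nonsoluble_minnormal_no_complement minN nsNG nsolN p_N).
have memX (H : {group gT}) : H \in HH -> ~~ cyclic H -> H \subset X.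
  by move=> hH ncH; apply: sAX; rewrite mem_enum inE hH.
have [H hH p_H] := piHH p (piSg sNG p_N).
have [P sylP] := Sylow_exists p H.
have SylG (q : nat) (K S : {group gT}) : K \in HH -> q \in \pi(K) ->
  q.-Sylow(K) S -> q.-Sylow(G) S.
  move=> hK q_K; apply: subHall_Sylow q_K; apply: Hall_pi.
  by case: (HallHH K hK).
have sylPN := Hall_setI_normal nsNG (SylG p H P hH p_H sylP).
have ncH : ~~ cyclic H.
  apply: contra (ncSyl _ sylPN) => cycH; apply: cyclicS cycH.
  by rewrite subIset ?(pHall_sub sylP).
have sPX : P :&: N \subset X.
  by rewrite subIset // (subset_trans (pHall_sub sylP)) // memX.
have abP : abelian (P :&: N) := abelianS sPX abX.
apply: (smallest_prime_complement p_pr min_p sylPN abP) => s s_N ne_sp.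
have [K hK s_K] := piHH s (piSg sNG s_N).
have [S sylS] := Sylow_exists s K.
have sylSN := Hall_setI_normal nsNG (SylG s K S hK s_K sylS).
have [cycK|ncK] := boolP (cyclic K); last first.
  (* For noncyclic K both Sylow subgroups lie in the abelian group X. *)
  exists (S :&: N)%G => //; apply/orP; left.
  apply: subset_trans (centS sPX); apply: subset_trans abX.
  by rewrite subIset // (subset_trans (pHall_sub sylS)) // memX.
(* Z is supersoluble, so its Hall subgroup O for primes above p is normal. The Sylow p-subgroup of N
   acts coprimely on O and normalises a Sylow s-subgroup R of it, which is conjugate in Z to the
   cyclic intersection of S and N. *)
pose Z := ((X <*> K) :&: N)%G.
have ssZ : supersoluble Z := supersolubleS (subsetIl _ _) (ssY K hK cycK).
have sPZ : P :&: N \subset Z.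
  by rewrite subsetI subsetIr (subset_trans sPX) ?joing_subl.
have sZN : Z \subset N := subsetIr _ _.
have sylSZ : s.-Sylow(Z) (S :&: N).
  apply: pHall_subl sZN sylSN; rewrite subsetI subsetIr andbT subIset //.
  by rewrite (subset_trans (pHall_sub sylS)) ?joing_subr.
pose O := 'O_(gt_pred p)(Z)%G.
have hallO : (gt_pred p).-Hall(Z) O by apply: supersoluble_Hall_gt.
have gts : s \in gt_pred p by rewrite !inE ltn_neqAle eq_sym ne_sp min_p.
have nOP : P :&: N \subset 'N(O).
  exact: subset_trans sPZ (normal_norm (pcore_normal _ _)).
have pPN := pHall_pgroup sylPN.
have coOP : coprime #|O| #|P :&: N|.
  rewrite coprime_sym; apply: pnat_coprime pPN _.
  apply: sub_pgroup (pcore_pgroup _ _) => q; rewrite !inE.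
  by apply: contraTneq => ->; rewrite ltnn.
have [R sylR nRP] := sol_coprime_Sylow_exists s (abelian_sol abP) nOP coOP.
have sylRZ := subHall_Sylow hallO gts sylR.
have cycR : cyclic R.
  have [x _ ->] := Sylow_trans sylSZ sylRZ.
  by rewrite cyclicJ (cyclicS _ cycK) // subIset ?(pHall_sub sylS).
exists R; last by rewrite cycR nRP orbT.
rewrite pHallE (subset_trans (pHall_sub sylRZ)) //=.
by rewrite (card_Hall sylRZ) -(card_Hall sylSZ) (card_Hall sylSN).
Qed.

End NonPermuting.

(** * Conclusion: induction on |G| and translation of the hypotheses *)

Lemma Hall_family_supersoluble (gT : finGroupType) (G : {group gT})
  (HH : {set {group gT}}) :
  Hall_family G HH -> supersoluble G.
Proof.
have [n] := ubnP #|G|; elim: n gT G HH => // n IHn gT G HH ltGn famG.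
have [G1|ntG] := eqsVneq G 1; first exact: supersoluble1.
have ssGC (C : {group gT}) : C <| G -> C :!=: 1 -> supersoluble (G / C)%G.
  move=> nsCG ntC; apply: IHn (Hall_family_quotient nsCG famG).
  exact: leq_trans (ltn_quotient ntC (normal_sub nsCG)) ltGn.
have IH (D : {group gT}) (KK : {set {group gT}}) :
    D \proper G -> Hall_family D KK -> supersoluble D.
  by move=> pDG; apply: IHn; apply: leq_trans (proper_card pDG) ltGn.
case: (pickP (fun C : {group gT} => [&& C <| G, solvable C & C :!=: 1])).
  move=> C /and3P[nsCG solC ntC].
  apply: (soluble_Hall_family_supersoluble famG _ ssGC).
  by rewrite (series_sol nsCG) solC (supersoluble_sol (ssGC C nsCG ntC)).
move=> nosol'; have nosol (C : {group gT}) : C <| G -> solvable C -> C :=: 1.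
  move=> nsCG solC; apply/eqP/negPn/negP=> ntC.
  by have := nosol' C; rewrite nsCG solC ntC.
have [N minN sNG] : {N : {group gT} | minnormal N G & N \subset G}.
  by apply: mingroup_exists; rewrite ntG normG.
have /andP[ntN nNG] := mingroupp minN.
have nsNG : N <| G by rewrite /normal sNG.
have nsolN : ~~ solvable N by apply: contra ntN => solN; apply/eqP/nosol.
case: (pickP (fun HK : {group gT} * {group gT} =>
    [&& HK.1 \in HH, HK.2 \in HH & HK.1 * HK.2 != HK.2 * HK.1])).
  move=> [H K] /and3P[/= hH hK /eqP ncHK].
  by case: (nonpermuting_family_contra famG IH nosol minN nsNG);
    exists H => //; exists K.
move=> perm; case: (permuting_family_contra minN nsNG nsolN famG ssGC) =>
  H K hH hK.
by have := perm (H, K); rewrite /= hH hK /= => /negbFE/eqP.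
Qed.

Theorem theoremA (I : Type) (sigma : I -> nat_pred) (gT : finGroupType)
    (G : {group gT}) (HH : {set {group gT}}) :
  prime_partition sigma ->
  complete_Hall_set sigma G HH ->
  (forall H : {group gT}, H \in HH -> supersoluble H) ->
  (forall H : {group gT}, H \in HH -> ~~ cyclic H ->
     forall M : {group gT}, maximal M H ->
     forall K : {group gT}, K \in HH -> K <> H -> permutes M K) ->
  supersoluble G.
Proof.
move=> [sigma_pr cover_sigma disj_sigma] [sHHG hallHH uniqHH] ssHH maxHH.
apply: (@Hall_family_supersoluble _ _ HH); split.
- move=> H hH; split; last exact: ssHH.
  have [->|ntH] := eqsVneq H 1; first exact: Hall1.
  by have [i /pHall_Hall] := hallHH H hH ntH.
- move=> H K hH hK neHK.
  have [->|ntH] := eqsVneq H 1; first by rewrite cards1 coprime1n.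
  have [->|ntK] := eqsVneq K 1; first by rewrite cards1 coprimen1.
  have [[i hallH] [j hallK]] := (hallHH H hH ntH, hallHH K hK ntK).
  apply/negPn/negP=> ncoHK.
  have [p p_H p_K] : exists2 p, p \in \pi(H) & p \in \pi(K).
    move: ncoHK; rewrite coprime_has_primes ?cardG_gt0 // negbK.
    by case/hasP=> p p_K p_H; exists p.
  have sigma_p k (L : {group gT}) : (sigma k).-Hall(G) L -> p \in \pi(L) ->
    p \in sigma k.
    move=> /pHall_pgroup sL; rewrite mem_primes => /and3P[p_pr _].
    exact: (pgroupP sL).
  have i_p := sigma_p i H hallH p_H; have j_p := sigma_p j K hallK p_K.
  (* If i = j, uniqueness of the Hall subgroup for this block gives H = K; the block meets pi(G)
     because it contains p. *)
  apply: (disj_sigma i j _ p (conj i_p j_p)) => eq_ij.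
  have [|L [_ uniqL]] := uniqHH i.
    by exists p; rewrite i_p (piSg (sHHG _ hH)).
  case/eqP: neHK; rewrite -(uniqL H) //; apply: uniqL.
  by rewrite eq_ij.
- move=> p p_G; have p_pr : prime p.
    by move: p_G; rewrite mem_primes => /and3P[].
  have [i i_p] := cover_sigma p p_pr.
  have [|H [[hH hallH] _]] := uniqHH i; first by exists p.
  exists H => //; have /= -> := card_Hall hallH.
  rewrite pi_of_part ?cardG_gt0 //.
  by rewrite inE /= p_G.
move=> H K hH hK ncH neKH M maxM; apply: (maxHH H hH ncH M maxM K hK).
exact/eqP.
Qed.
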